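(* Let $2\le s<\infty$ with Hölder conjugate $s'$, and let $\mathcal R(\varphi)$ be either one of the following two quantities: (i) $\mathcal R(\varphi)=\dfrac{\|\varphi\|_{L^p(\mathbb T)}\|\varphi\|_{L^q(\mathbb T)}}{\|\varphi\|_{L^r(\mathbb T)}}$, where $1\le p,q,r\le\infty$ satisfy $\frac1p+\frac1q-\frac1r\ge 1+\frac1s$; or (ii) $\mathcal R(\varphi)=\dfrac{\|\varphi\|_{L^1(\mathbb T)}^{1+r'/s}}{\|\varphi\|_{L^r(\mathbb T)}^{r'/s}}$, where $r\in(1,\infty]$ and $r'$ is the Hölder conjugate of $r$. Then there exists a constant $c>0$, depending only on $p,q,r,s$ (only on $r,s$ in case (ii)), such that for all integers $n\ge 1$, all $m\ge 0$, and all nonzero $\varphi\in \mathcal FL^{s'}_m(\mathbb T)\cap C(\mathbb T,\mathbb R)$ with zero mean and $N_\varphi<\infty$, $$\|\mathcal P_n\varphi\|_{\mathcal FL^{s'}_{-1}(\mathbb T)}\;\ge\; c\,\frac{\mathcal R(\varphi)}{N_\varphi}-n^{-(m+1)}\|\varphi\|_{\mathcal FL^{s'}_m(\mathbb T)} .$$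
   Context: $\mathbb T=\mathbb R/\mathbb Z$ is the one-dimensional torus with normalized Lebesgue measure (total mass $1$); $\hat\varphi(k)=\int_{\mathbb T}\varphi(x)e^{-2\pi i kx}\,dx$; zero mean means $\int_{\mathbb T}\varphi\,dx=0$. For $m\in\mathbb R$ and $1\le p<\infty$, the Fourier–Lebesgue seminorm is $$\|\varphi\|_{\mathcal FL^p_m(\mathbb T)}:=\Big(\sum_{k\in\mathbb Z\setminus\{0\}}|k|^{mp}|\hat\varphi(k)|^p\Big)^{1/p},$$ and $\varphi\in\mathcal FL^p_m(\mathbb T)$ means that this is finite. For mean-zero $\varphi\in L^2(\mathbb T)$, $\mathcal P_n\varphi(x):=\sum_{0<|k|\le n}\hat\varphi(k)e^{2\pi i kx}$. $N_\varphi$ denotes the number of times $\varphi$ changes sign on $\mathbb T$, i.e. the largest $M$ for which there are cyclically ordered distinct points $x_1,\dots,x_M\in\mathbb T$ with $\varphi(x_j)\varphi(x_{j+1})<0$ for $j=1,\dots,M$, where $x_{M+1}:=x_1$. The convention $1/\infty=0$ is used. *)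

(* Defs.v *)
From HB Require Import structures.
From mathcomp Require Import all_boot all_order all_algebra.
From mathcomp Require Import complex.
From mathcomp Require Import all_classical all_reals all_analysis.

Set Implicit Arguments.
Unset Strict Implicit.
Unset Printing Implicit Defensive.

Import Order.TTheory GRing.Theory Num.Theory.
Import numFieldNormedType.Exports.

Local Open Scope classical_set_scope.
Local Open Scope ring_scope.
Local Open Scope complex_scope.

(* Functions on T = R/Z are 1-periodic functions on the real line, and the
   normalized measure of T is the Lebesgue measure of the fundamental domain
   [0, 1[. *)
Definition torus_measure (R : realType) :
    {measure set (measurableTypeR R) -> \bar R} :=
  mrestr (@lebesgue_measure R) (measurable_itv `[0%R, 1%R[).

Definition torus_continuous (R : realType) (phi : R -> R) : Prop :=
  periodic phi 1 /\ continuous phi.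

Definition torus_Lnorm (R : realType) (p : \bar R) (phi : R -> R) : \bar R :=
  ('N[torus_measure R]_p[EFin \o phi])%E.

Definition expi (R : realType) (t : R) : R[i] := cos t +i* sin t.

(* For a complex-valued integrand, the integral is taken componentwise. *)
Definition torus_integral (R : realType) (f : R -> R[i]) : R[i] :=
  Rintegral (torus_measure R) setT (fun x => complex.Re (f x)) +i*
  Rintegral (torus_measure R) setT (fun x => complex.Im (f x)).

Definition fourier_coef (R : realType) (f : R -> R[i]) (k : int) : R[i] :=
  torus_integral (fun x => f x * expi (- (2 * pi * k%:~R * x))).

Definition FL_norm (R : realType) (p m : R) (f : R -> R[i]) : \bar R :=
  ((\esum_(k in [set k : int | (k != 0)%R])
      ((`|k|%:~R `^ (m * p) * Normc.normc (fourier_coef f k) `^ p)%R)%:E)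
   `^ p^-1)%E.

Definition fourier_trunc (R : realType) (n : nat) (f : R -> R[i]) :
    R -> R[i] := fun x =>
  \sum_(k \in [set k : int | 0 < `|k| <= n%:Z])
    fourier_coef f k * expi (2 * pi * k%:~R * x).

(* Real lifts x_0 < ... < x_(M-1) < x_0 + 1 encode M cyclically ordered distinct
   points of T; [ordS] is the cyclic successor on 'I_M. *)
Definition sign_alternates (R : realType) (phi : R -> R) (M : nat) : Prop :=
  exists x : 'I_M -> R,
    [/\ forall i j : 'I_M, (i < j)%N -> x i < x j,
        forall i j : 'I_M, x i < x j + 1 &
        forall j : 'I_M, phi (x j) * phi (x (ordS j)) < 0].

(* The number of sign changes of phi on T is finite and equal to N. *)
Definition is_sign_changes (R : realType) (phi : R -> R) (N : nat) : Prop :=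
  sign_alternates phi N /\ forall M, sign_alternates phi M -> (M <= N)%N.

Definition Lnorm_ratio (R : realType) (p q r : \bar R) (phi : R -> R) :
    \bar R :=
  (torus_Lnorm p phi * torus_Lnorm q phi / torus_Lnorm r phi)%E.

(* Here r' is the Hoelder conjugate of r. *)
Definition L1_ratio (R : realType) (s : R) (r : \bar R) (r' : R)
    (phi : R -> R) : \bar R :=
  (torus_Lnorm 1 phi `^ (1 + r' / s) / torus_Lnorm r phi `^ (r' / s))%E.

(* Main.v *)
Require Import Defs.
From mathcomp Require Import all_boot all_order all_algebra.
From mathcomp Require Import complex ring lra zify.
From mathcomp Require Import all_classical all_reals all_analysis.
From mathcomp Require Import measurable_realfun ess_sup_inf.

Set Implicit Arguments.
Unset Strict Implicit.
Unset Printing Implicit Defensive.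

Import Order.TTheory GRing.Theory Num.Theory.
Import numFieldNormedType.Exports.

Local Open Scope classical_set_scope.
Local Open Scope ring_scope.
Local Open Scope complex_scope.

(** Let F be the primitive of phi with zero mean. Its Fourier coefficients are
    those of phi divided by 2 pi i k, so the norm of phi in FL^s'_{-1} is, up
    to a constant, the l^s' norm of the coefficients of F. Two facts about F
    are played against each other.

    Few sign changes make F large on a large set ([level_mass]). The total
    variation of lam atan (F / lam), a bounded function whose derivative
    has the sign of phi, is at most a constant times lam N; since this
    derivative is comparable to phi where |F| <= lam, at most half of the mass
    a = |phi|_1 lies there when lam = a / (32 N). By Hoelder's inequality the
    set where |F| > lam then has measure at least (a / (2 |phi|_r))^r'.

    Small coefficients make this set small ([weak_type_primitive]): its measure
    is at most (2 tau / lam)^s when the l^s' norm of the amplitudes of F is at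
    most tau. This is the weak-type Hausdorff-Young inequality. It is
    enough here because a single level lam is involved, and it has an elementary
    proof: large coefficients are summed absolutely, small ones are estimated in
    L^2 by orthogonality ([weak_hausdorff_young]). It passes from trigonometric
    sums to F because the Fourier series of F converges pointwise
    ([partial_fourier_cvg]).

    Comparing the two bounds gives
      |phi|_1^(1 + r'/s) / |phi|_r^(r'/s) <= C N tau
    ([sign_change_bound]), which is case (ii) without truncation. Case (i)
    reduces to case (ii) by interpolating L^p and L^q between L^1 and L^r
    ([torus_Lnorm_interpolation], [Lnorm_ratio_le_L1]); the condition on the
    exponents is exactly what this requires, and it forces r > 1 and p, q
    finite. Finally the frequencies above n cost at most
    n^-(m+1) times the norm in FL^s'_m ([truncation_bound]). *)

Section Auxiliary.
Context {R : realType}.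
Local Notation leb := (@lebesgue_measure R).
Local Notation I01 := (`[0%R, 1%R]%classic : set R).
Implicit Types (f g G F : R -> R) (a b : R).

(** * Integration over the unit interval *)

(** A class closed under sums and products and contained in L^1, so that one
    closure property discharges all integrability side conditions; it also
    contains the discontinuous quotient met in the Dirichlet argument. *)
Definition bounded_measurable f : Prop :=
  measurable_fun I01 f /\ exists M : R, forall x, I01 x -> `|f x| <= M.

Definition unit_integral f : R := \int[leb]_(x in I01) f x.

Lemma leb_I01 : leb I01 = 1%E.
Proof. by rewrite lebesgue_measure_itv /= lte_fin ltr01 oppr0 adde0. Qed.

Lemma bm_integrable f : bounded_measurable f -> leb.-integrable I01 (EFin \o f).
Proof.
move=> [mf [M fM]]; apply: measurable_bounded_integrable => //=.
  by rewrite lebesgue_measure_itv /= lte_fin ltr01 ltry.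
exists M; split; first exact: num_real.
by move=> N MN x xI; apply: le_trans (fM x xI) (ltW MN).
Qed.

Lemma bm_cst a : bounded_measurable (fun=> a).
Proof. by split=> //; exists `|a|. Qed.

Lemma bmD f g : bounded_measurable f -> bounded_measurable g ->
  bounded_measurable (fun x => f x + g x).
Proof.
move=> [mf [M fM]] [mg [N gN]]; split; first exact: measurable_funD.
by exists (M + N) => x xI; rewrite (le_trans (ler_normD _ _))// lerD ?fM ?gN.
Qed.

Lemma bmM f g : bounded_measurable f -> bounded_measurable g ->
  bounded_measurable (fun x => f x * g x).
Proof.
move=> [mf [M fM]] [mg [N gN]]; split; first exact: measurable_funM.
by exists (M * N) => x xI; rewrite normrM ler_pM ?fM ?gN.
Qed.

Lemma bmZ a f : bounded_measurable f -> bounded_measurable (fun x => a * f x).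
Proof. by move=> bf; apply: bmM => //; exact: bm_cst. Qed.

Lemma bmB f g : bounded_measurable f -> bounded_measurable g ->
  bounded_measurable (fun x => f x - g x).
Proof.
move=> bf bg; have := bmD bf (bmZ (-1) bg).
by under eq_fun do rewrite mulN1r.
Qed.

Lemma bm_norm f : bounded_measurable f -> bounded_measurable (fun x => `|f x|).
Proof.
move=> [mf [M fM]]; split; first exact: measurableT_comp.
by exists M => x xI; rewrite normr_id fM.
Qed.

Lemma bm_indic (E : set R) : measurable E -> bounded_measurable \1_E.
Proof.
move=> mE; split; first exact: measurable_indic.
by exists 1 => x _; rewrite indicE; case: (_ \in _); rewrite ?normr1 ?normr0.
Qed.

Lemma bm_sum (I : Type) (r : seq I) (P : pred I) (F : I -> R -> R) :
  (forall i, bounded_measurable (F i)) ->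
  bounded_measurable (fun x => \sum_(i <- r | P i) F i x).
Proof.
move=> bF; elim: r => [|i r IH].
  by under eq_fun do rewrite big_nil; exact: bm_cst.
under eq_fun do rewrite big_cons.
by case: (P i) => //; exact: bmD.
Qed.

Lemma bm_continuous f : {within I01, continuous f} -> bounded_measurable f.
Proof.
move=> cf; split.
  by apply: subspace_continuous_measurable_fun => //.
have : compact (f @` I01).
  by apply: continuous_compact => //; exact: segment_compact.
move=> /compact_bounded[M [_ fM]]; exists (M + 1) => x xI.
by apply: (fM (M + 1)); [rewrite ltrDl|exists x].
Qed.

Lemma bm_continuousT f : continuous f -> bounded_measurable f.
Proof. by move=> cf; apply: bm_continuous; exact: continuous_subspaceT. Qed.

Lemma unit_integralD f g : bounded_measurable f -> bounded_measurable g ->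
  unit_integral (fun x => f x + g x) = unit_integral f + unit_integral g.
Proof. by move=> bf bg; apply: RintegralD => //; exact: bm_integrable. Qed.

Lemma unit_integralB f g : bounded_measurable f -> bounded_measurable g ->
  unit_integral (fun x => f x - g x) = unit_integral f - unit_integral g.
Proof. by move=> bf bg; apply: RintegralB => //; exact: bm_integrable. Qed.

Lemma unit_integralZ a f : bounded_measurable f ->
  unit_integral (fun x => a * f x) = a * unit_integral f.
Proof. by move=> bf; apply: RintegralZl => //; exact: bm_integrable. Qed.

Lemma unit_integral_cst a : unit_integral (fun=> a) = a.
Proof.
by rewrite /unit_integral Rintegral_cst// (_ : fine _ = 1) ?mulr1//= leb_I01.
Qed.

Lemma unit_integral_sum (I : Type) (r : seq I) (P : pred I) (F : I -> R -> R) :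
  (forall i, bounded_measurable (F i)) ->
  unit_integral (fun x => \sum_(i <- r | P i) F i x) =
  \sum_(i <- r | P i) unit_integral (F i).
Proof.
move=> bF; elim: r => [|i r IH].
  by rewrite big_nil; under [X in unit_integral X]eq_fun do rewrite big_nil;
     rewrite unit_integral_cst.
rewrite big_cons; under [X in unit_integral X]eq_fun do rewrite big_cons.
by case: (P i) => //; rewrite unit_integralD// ?IH//; exact: bm_sum.
Qed.

Lemma unit_integral_ge0 f : (forall x, I01 x -> 0 <= f x) -> 0 <= unit_integral f.
Proof. by move=> f0; apply: Rintegral_ge0. Qed.

Lemma le_unit_integral f g : bounded_measurable f -> bounded_measurable g ->
  (forall x, I01 x -> f x <= g x) -> unit_integral f <= unit_integral g.
Proof. by move=> bf bg fg; apply: le_Rintegral => //; exact: bm_integrable. Qed.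

Lemma eq_unit_integral f g : (forall x, I01 x -> f x = g x) ->
  unit_integral f = unit_integral g.
Proof. by move=> fg; apply: eq_Rintegral => x; rewrite inE; exact: fg. Qed.

(** The endpoint 1 is harmless: it has measure zero, and closed intervals are
    the ones on which the fundamental theorem of calculus applies. *)
Lemma ge0_integral_torus (f : R -> \bar R) : measurable_fun setT f ->
  (forall x, 0 <= f x)%E ->
  (\int[torus_measure R]_x f x = \int[leb]_(x in I01) f x)%E.
Proof.
move=> mf f0.
rewrite -integral_itv_bndo_bndc; last exact: measurable_funS mf.
rewrite (@ge0_negligible_integral _ _ _ _ setT
  (~` (`[0, 1[%classic : set (measurableTypeR R))))//; last 2 first.
- exact: measurableC.
- by rewrite /= /mrestr setICl measure0.
rewrite setTD setCK; apply: eq_measure_integral => A mA AD.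
by rewrite /torus_measure /= /mrestr setIidl.
Qed.

Lemma integral_torus (f : R -> \bar R) : measurable_fun setT f ->
  (\int[torus_measure R]_x f x = \int[leb]_(x in I01) f x)%E.
Proof.
move=> mf; rewrite integralE [RHS]integralE !ge0_integral_torus//.
- exact: measurable_funeneg.
- exact: measurable_funepos.
Qed.

Lemma Rintegral_torus f : continuous f ->
  Rintegral (torus_measure R) setT f = unit_integral f.
Proof.
move=> cf; congr fine; apply: integral_torus.
by apply/measurable_EFinP; exact: continuous_measurable_fun.
Qed.

Lemma torus_measureE (A : set R) : measurable A ->
  torus_measure R A = leb (I01 `&` A).
Proof.
move=> mA.
transitivity (\int[torus_measure R]_x (\1_A x)%:E)%E.
  by rewrite integral_indic// setIT.
rewrite ge0_integral_torus//; first by rewrite integral_indic// setIC.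
by apply/measurable_EFinP; exact: measurable_indic.
Qed.

(** * Alternating points and total variation *)

Lemma continuous_itv_integrable g a b : continuous g ->
  leb.-integrable `[a, b] (EFin \o g).
Proof.
move=> cg; apply: continuous_compact_integrable; first exact: segment_compact.
exact: continuous_subspaceT.
Qed.

Lemma Rintegral_derive g G a b : a <= b -> continuous g ->
  (forall x, a <= x <= b -> is_derive x 1 G (g x)) ->
  \int[leb]_(x in `[a, b]) g x = G b - G a.
Proof.
rewrite le_eqVlt => /predU1P[<- _ _|ab cg dG].
  by rewrite set_itv1 Rintegral_set1 subrr.
have cG x : a <= x <= b -> {for x, continuous G}.
  by move=> /dG[dGx _]; apply/differentiable_continuous/derivable1_diffP.
rewrite /Rintegral (@continuous_FTC2 _ g G)//.
- exact: continuous_subspaceT.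
- split.
  + move=> x; rewrite in_itv /= => /andP[/ltW ax /ltW xb].
    by have [] := dG x; rewrite ?ax.
  + by apply: cvg_at_right_filter; apply: cG; rewrite lexx ltW.
  + by apply: cvg_at_left_filter; apply: cG; rewrite lexx ltW.
- move=> x; rewrite in_itv /= => /andP[/ltW ax /ltW xb].
  by rewrite derive1E; have [|_ ->] := dG x; rewrite ?ax.
Qed.

(** The linear, non-cyclic counterpart of [sign_alternates]: it splits well at
    a point, which the induction on the number of sign changes needs. The
    points are interior so that values at the endpoints are irrelevant. *)
Definition alternating g a b (s : seq R) : bool :=
  all (fun x => a < x < b) s && sorted (fun u v => (u < v) && (g u * g v < 0)) s.

Lemma integral_norm_constant_sign g G a b : a <= b -> continuous g ->
  (forall x, a <= x <= b -> is_derive x 1 G (g x)) ->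
  (forall u v, a < u < b -> a < v < b -> 0 <= g u * g v) ->
  \int[leb]_(x in `[a, b]) `|g x| = `|G b - G a|.
Proof.
move=> ab cg dG sg.
have cng : continuous (fun x => `|g x|) by move=> x; apply: cvg_norm; exact: cg.
have [e eE ge] : exists2 e : R, `|e| = 1 & forall x, a < x < b -> `|g x| = e * g x.
  have [gp|] := pselect (forall x, a < x < b -> 0 <= g x).
    by exists 1; [rewrite normr1|move=> x xI; rewrite mul1r ger0_norm// gp].
  move=> /existsNP[u /not_implyP[uI /negP]]; rewrite -ltNge => gu.
  exists (-1); first by rewrite normrN1.
  by move=> x xI; rewrite mulN1r ler0_norm// -(nmulr_rge0 _ gu) sg.
have nE : \int[leb]_(x in `[a, b]) `|g x| = \int[leb]_(x in `[a, b]) (e * g x).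
  have oo h : continuous h ->
      \int[leb]_(x in `[a, b]) h x = \int[leb]_(x in `]a, b[) h x.
    move=> ch; rewrite /Rintegral integral_itv_bndoo//.
    apply/measurable_EFinP; apply: measurable_funS (continuous_measurable_fun ch) => //.
  rewrite !oo//; first by apply: eq_Rintegral => x; rewrite inE /= in_itv /=; exact: ge.
  by move=> x; apply: cvgM; [exact: cvg_cst|exact: cg].
rewrite RintegralZl// in nE; last exact: continuous_itv_integrable.
rewrite (Rintegral_derive ab cg dG) in nE.
rewrite -[LHS]ger0_norm; last exact: Rintegral_ge0.
by rewrite nE normrM eE mul1r.
Qed.

Lemma no_alternating_pair g a b :
  (forall s, alternating g a b s -> (size s <= 1)%N) ->
  forall u v, a < u < b -> a < v < b -> 0 <= g u * g v.
Proof.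
move=> g1 u v uI vI; rewrite leNgt; apply/negP => guv.
have [uv|vu|E] := ltgtP u v; last by move: guv; rewrite E -expr2 ltNge sqr_ge0.
- by have := g1 [:: u; v]; rewrite /alternating /= uI vI uv guv => /(_ isT).
- by have := g1 [:: v; u]; rewrite /alternating /= uI vI vu mulrC guv => /(_ isT).
Qed.

(** A primitive that stays in [-B, B] moves by at most 2 B on each interval
    where its derivative has a constant sign. The induction cuts [a, b] at the
    supremum c of the points up to which the sign is constant: every point
    beyond c is preceded by points of both signs, so an alternating sequence
    in ]c, b[ can be prolonged to the left, and ]c, b[ allows one alternation
    fewer. *)
Lemma integral_norm_alternations g G a b B K : a <= b -> continuous g ->
  (forall x, a <= x <= b -> is_derive x 1 G (g x)) ->
  (forall x, a <= x <= b -> `|G x| <= B) ->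
  (forall s, alternating g a b s -> (size s <= K.+1)%N) ->
  \int[leb]_(x in `[a, b]) `|g x| <= 2 * B * K.+1%:R.
Proof.
elim: K a => [|K IH] a ab cg dG GB gK.
  rewrite mulr1 (integral_norm_constant_sign ab cg dG); last first.
    move=> u v uI vI.
    exact: no_alternating_pair gK _ _ uI vI.
  rewrite (le_trans (ler_normB _ _))// mulr_natl mulr2n.
  by rewrite lerD ?GB ?lexx ?ab.
pose S := [set x | a <= x <= b /\
  forall u v, a < u < x -> a < v < x -> 0 <= g u * g v].
have Sa : S a.
  split=> [|u v /andP[au ua]]; first by rewrite lexx.
  by have := lt_trans au ua; rewrite ltxx.
have ubS : ubound S b by move=> x [/andP[]].
have hS : has_sup S by split; [exists a|exists b].
pose c := sup S.
have ac : a <= c by apply: ub_le_sup => //; exists b.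
have cb : c <= b by apply: ge_sup => //; exists a.
have cng : continuous (fun x => `|g x|) by move=> x; apply: cvg_norm; exact: cg.
have -> : \int[leb]_(x in `[a, b]) `|g x| =
   \int[leb]_(x in `[a, c]) `|g x| + \int[leb]_(x in `[c, b]) `|g x|.
  apply/eqP; rewrite addrC -subr_eq; apply/eqP.
  rewrite (@Rintegral_itvB _ _ (BLeft a) (BRight b) c) ?bnd_simp//; last first.
    exact: continuous_itv_integrable.
  rewrite Rintegral_itv_obnd_cbnd//.
  apply: integrableS (continuous_itv_integrable c b cng) => //.
  exact: subset_itv_oc_cc.
rewrite -[K.+2]addn1 natrD mulrDr mulr1 [leLHS]addrC lerD//.
  apply: IH => //.
  - by move=> x /andP[cx xb]; apply: dG; rewrite xb (le_trans ac).
  - by move=> x /andP[cx xb]; apply: GB; rewrite xb (le_trans ac).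
  move=> s; apply: contraTT; rewrite -ltnNge.
  case: s => [//|y [//|y1 s]] sK; apply/negP => /andP[/= /andP[/andP[cy yb] sI]].
  move=> ss; have gyy1 : g y * g y1 < 0 by move: ss => /andP[/andP[]].
  have gy0 : g y != 0.
    by apply: contraTneq gyy1 => ->; rewrite mul0r ltxx.
  have : ~ S y by move=> Sy; have := ub_le_sup hS.2 Sy; rewrite leNgt cy.
  have ay : a < y by rewrite (le_lt_trans ac).
  move=> /not_andP[|]; first by rewrite (ltW ay) (ltW yb).
  move=> /existsNP[u /existsNP[v /not_implyP[uI /not_implyP[vI /negP]]]].
  rewrite -ltNge => guv.
  have [z zI gz] : exists2 z, a < z < y & g z * g y < 0.
    have [gu|gu] := ltP (g u * g y) 0; first by exists u.
    exists v => //; rewrite ltNge; apply/negP => gv.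
    have := mulr_ge0 gu gv; rewrite mulrACA -expr2 leNgt => /negP; apply.
    by rewrite nmulr_rlt0// exprn_even_gt0.
  have /andP[az zy] := zI.
  have := gK (z :: y :: y1 :: s).
  rewrite /alternating /= az zy gz yb ay (lt_trans zy)//=.
  move: ss; rewrite /= => ->; rewrite andbT.
  case/andP: sI => /andP[cy1 ->] sI.
  rewrite (le_lt_trans ac cy1)/=.
  have -> : all (fun x => a < x < b) s.
    by apply: sub_all sI => x /andP[cx ->]; rewrite (le_lt_trans ac).
  by move=> /(_ isT); rewrite [size _]/= ltnS leqNgt sK.
have dGc x : a <= x <= c -> is_derive x 1 G (g x).
  by move=> /andP[ax xc]; apply: dG; rewrite ax (le_trans xc).
rewrite (integral_norm_constant_sign ac cg dGc).
  rewrite (le_trans (ler_normB _ _))// mulr_natl mulr2n.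
  by rewrite lerD ?GB ?lexx ?ab ?ac.
move=> u v /andP[au uc] /andP[av vc].
have : Num.max u v < c by rewrite gt_max uc.
move=> /(sup_gt hS.1)[x [_ xS]]; rewrite gt_max => /andP[ux vx].
by apply: xS; rewrite ?au ?av.
Qed.

(** Along an alternating sequence the sign at rank i is (-1)^i times the first
    one, so for an even size the last and the first points have opposite signs
    and the sequence closes up cyclically. *)
Lemma alternating_sign_alternates g s : g (head 0 s) != 0 -> ~~ odd (size s) ->
  alternating g 0 1 s -> sign_alternates g (size s).
Proof.
rewrite -nth0 => g0 evs /andP[/allP s01 /(sortedP 0) ss].
have slt : sorted <%R s by apply/(sortedP 0) => i /ss /andP[].
have sgn i : (i < size s)%N -> 0 < (-1) ^+ i * (g s`_0 * g s`_i).
  elim: i => [_|i IH iS].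
    by rewrite mul1r -expr2 exprn_even_gt0.
  have /IH := ltnW iS; have /andP[_] := ss _ iS => gi.
  rewrite exprS => gp.
  have gi0 : g s`_i != 0 by apply: contraTneq gi => ->; rewrite mul0r ltxx.
  rewrite -(pmulr_lgt0 _ gp).
  have -> : -1 * (-1) ^+ i * (g s`_0 * g s`_i.+1) * ((-1) ^+ i * (g s`_0 * g s`_i)) =
     - (g s`_i * g s`_i.+1) * (g s`_0 * (-1) ^+ i) ^+ 2 by ring.
  rewrite mulr_gt0 ?oppr_gt0// exprn_even_gt0//= mulf_neq0 ?signr_eq0//.
exists (fun i => s`_i); split.
- by move=> i j ij; rewrite lt_sorted_ltn_nth ?inE.
- move=> i j; have := s01 _ (mem_nth 0 (ltn_ord i)).
  have := s01 _ (mem_nth 0 (ltn_ord j)).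
  by move=> /andP[j0 _] /andP[_ i1]; rewrite (lt_trans i1)// ltrDr.
- move=> j; have jS := ltn_ord j.
  have [jS1|] := ltnP j.+1 (size s).
    by rewrite /= modn_small//; have /andP[] := ss _ jS1.
  move=> sj; have sE : size s = j.+1 by apply/eqP; rewrite eqn_leq sj.
  have oj : odd j by move: (congr1 odd sE); rewrite (negbTE evs) /= => /esym/negbFE.
  have -> : nat_of_ord (ordS j) = 0%N by rewrite /= -[X in (X %% _)%N]sE modnn.
  by have := sgn _ jS; rewrite -signr_odd oj mulN1r oppr_gt0 mulrC.
Qed.

(** An odd sequence becomes cyclic after dropping its last point, whence the
    successor. *)
Lemma size_alternating g s N : is_sign_changes g N ->
  alternating g 0 1 s -> (size s <= N.+1)%N.
Proof.
move=> [_ gN]; case: s => [//|x [|y s]] alt; first by [].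
set t := y :: s in alt *.
have gx : g x != 0.
  move: alt => /andP[_ /= /andP[/andP[_ gxy] _]].
  by apply: contraTneq gxy => ->; rewrite mul0r ltxx.
pose n := (size (x :: t) - odd (size (x :: t)))%N.
have n0 : (0 < n)%N by rewrite /n /=; case: odd; lia.
have sz : size (take n (x :: t)) = n by rewrite size_takel// leq_subr.
have := gN n; rewrite -{1}sz.
have h : alternating g 0 1 (take n (x :: t)).
  move: alt => /andP[al so]; apply/andP; split.
    by apply/allP => z /mem_take; move/allP : al; exact.
  exact: take_sorted.
have hev : ~~ odd (size (take n (x :: t))) by rewrite sz /n oddB ?leq_b1// ; case: odd.
have hh : g (head 0 (take n (x :: t))) != 0 by case: (n) n0.
move=> /(_ (alternating_sign_alternates hh hev h)).
by rewrite /n; case: odd; lia.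
Qed.

(** * Trigonometric sums and Bessel's inequality *)

Lemma is_derive_affine a b (x : R) : is_derive x 1 (fun y => a * y + b) a.
Proof. by apply: is_derive_eq; rewrite addr0 -[RHS]mulr1. Qed.

Lemma is_derive_cos_affine a b (x : R) :
  is_derive x 1 (fun y => cos (a * y + b)) (- (a * sin (a * x + b))).
Proof.
have := is_derive1_comp (is_derive_cos _) (is_derive_affine a b x).
by rewrite mulNr mulrC.
Qed.

Lemma is_derive_sin_affine a b (x : R) :
  is_derive x 1 (fun y => sin (a * y + b)) (a * cos (a * x + b)).
Proof.
have := is_derive1_comp (is_derive_sin _) (is_derive_affine a b x).
by rewrite mulrC.
Qed.

Lemma continuous_cos_affine a b : continuous (fun y : R => cos (a * y + b)).
Proof.
move=> x; have [dx _] := is_derive_cos_affine a b x.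
exact/differentiable_continuous/derivable1_diffP.
Qed.

Lemma continuous_sin_affine a b : continuous (fun y : R => sin (a * y + b)).
Proof.
move=> x; have [dx _] := is_derive_sin_affine a b x.
exact/differentiable_continuous/derivable1_diffP.
Qed.

Lemma continuous_cos_linear a : continuous (fun x : R => cos (a * x)).
Proof. by have := @continuous_cos_affine a 0; under eq_fun do rewrite addr0. Qed.

Lemma continuous_sin_linear a : continuous (fun x : R => sin (a * x)).
Proof. by have := @continuous_sin_affine a 0; under eq_fun do rewrite addr0. Qed.

Lemma bm_cos_affine a b : bounded_measurable (fun y : R => cos (a * y + b)).
Proof. exact/bm_continuousT/continuous_cos_affine. Qed.

Lemma bm_sin_affine a b : bounded_measurable (fun y : R => sin (a * y + b)).
Proof. exact/bm_continuousT/continuous_sin_affine. Qed.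

Lemma bm_cos a : bounded_measurable (fun y : R => cos (a * y)).
Proof. exact/bm_continuousT/continuous_cos_linear. Qed.

Lemma bm_sin a : bounded_measurable (fun y : R => sin (a * y)).
Proof. exact/bm_continuousT/continuous_sin_linear. Qed.

Lemma sin_2pi_nat (k : nat) : sin (2 * pi * k%:R : R) = 0.
Proof.
have -> : 2 * pi * k%:R = 0 + pi *+ 2 *+ k :> R.
  by rewrite add0r mulr_natr mulr_natl.
by rewrite (periodicn (@sinD2pi R)) sin0.
Qed.

Lemma cos_2pi_nat (k : nat) : cos (2 * pi * k%:R : R) = 1.
Proof.
have -> : 2 * pi * k%:R = 0 + pi *+ 2 *+ k :> R.
  by rewrite add0r mulr_natr mulr_natl.
by rewrite (periodicn (@cosD2pi R)) cos0.
Qed.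

Lemma freq_gt0 (k : nat) : 0 < 2 * pi * k.+1%:R :> R.
Proof. by rewrite !mulr_gt0 ?pi_gt0. Qed.

Lemma unit_integral_cos (k : nat) b :
  unit_integral (fun x => cos (2 * pi * k.+1%:R * x + b)) = 0 :> R.
Proof.
set w := 2 * pi * k.+1%:R; have w0 : w != 0 by rewrite gt_eqF// freq_gt0.
have dG (x : R) : 0 <= x <= 1 ->
    is_derive x 1 (fun x => w^-1 * sin (w * x + b)) (cos (w * x + b)).
  move=> _; have h := is_derive_sin_affine w b x.
  by apply: is_derive_eq; rewrite -[_ *: _]/(_ * _) mulKf.
rewrite /unit_integral (Rintegral_derive ler01 _ dG); last exact: continuous_cos_affine.
rewrite mulr1 mulr0 add0r -mulrBr sinD cos_2pi_nat sin_2pi_nat mul0r add0r mul1r.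
by rewrite subrr mulr0.
Qed.

Lemma unit_integral_sin (k : nat) b :
  unit_integral (fun x => sin (2 * pi * k.+1%:R * x + b)) = 0 :> R.
Proof.
rewrite -[RHS](unit_integral_cos k (b - pi / 2)).
by apply: eq_unit_integral => x _; rewrite addrA cosBpihalf.
Qed.

Definition harmonic c d (k : nat) x : R :=
  c * cos (2 * pi * k%:R * x) + d * sin (2 * pi * k%:R * x).

Lemma bm_harmonic c d k : bounded_measurable (harmonic c d k).
Proof. by apply: bmD; apply: bmZ; [exact: bm_cos|exact: bm_sin]. Qed.

(** Product-to-sum formulas leave only the frequencies k - l and k + l + 2,
    and a nonzero frequency integrates to zero. *)
Lemma unit_integral_harmonicM c d c' d' (k l : nat) :
  unit_integral (fun x => harmonic c d k.+1 x * harmonic c' d' l.+1 x) =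
  (k == l)%:R * ((c * c' + d * d') / 2).
Proof.
wlog kl : c d c' d' k l / (l <= k)%N.
  have [/[swap]|/ltnW lk /(_ _ _ _ _ _ _ lk) h] := leqP l k; first exact.
  rewrite eq_sym [c * _]mulrC [d * _]mulrC -h.
  by apply: eq_unit_integral => x _; rewrite mulrC.
pose A := (c * c' + d * d') / 2; pose B := (c * c' - d * d') / 2.
pose C := (c * d' + d * c') / 2; pose D := (d * c' - c * d') / 2.
pose m := (k - l)%N; pose p := (k.+1 + l)%N.
transitivity (unit_integral (fun x =>
    A * cos (2 * pi * m%:R * x) + D * sin (2 * pi * m%:R * x) +
    (B * cos (2 * pi * p.+1%:R * x + 0) + C * sin (2 * pi * p.+1%:R * x + 0)))).
  apply: eq_unit_integral => x _; rewrite !addr0.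
  have -> : 2 * pi * m%:R * x = 2 * pi * k.+1%:R * x - 2 * pi * l.+1%:R * x.
    by rewrite /m -subSS natrB// mulrBr mulrBl.
  have -> : 2 * pi * p.+1%:R * x = 2 * pi * k.+1%:R * x + 2 * pi * l.+1%:R * x.
    by rewrite /p -addnS natrD mulrDr mulrDl.
  rewrite /harmonic cosB sinB cosD sinD /A /B /C /D.
  by field.
have bA := bmZ A (bm_cos (2 * pi * m%:R)); have bD := bmZ D (bm_sin (2 * pi * m%:R)).
have bB := bmZ B (bm_cos_affine (2 * pi * p.+1%:R) 0).
have bC := bmZ C (bm_sin_affine (2 * pi * p.+1%:R) 0).
rewrite unit_integralD ?unit_integralZ//; try exact: bmD.
rewrite unit_integralD// [X in _ + X]unit_integralD// !unit_integralZ//; last 4 first.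
- exact: bm_sin_affine.
- exact: bm_cos_affine.
- exact: bm_sin.
- exact: bm_cos.
rewrite unit_integral_cos unit_integral_sin !mulr0 addr0.
have [E|kl'] := eqVneq k l.
  have -> : m = 0%N by rewrite /m E subnn.
  under eq_unit_integral do rewrite mulr0 mul0r cos0.
  under [X in _ + D * X]eq_unit_integral do rewrite mulr0 mul0r sin0.
  by rewrite !unit_integral_cst mulr0 !addr0 mulr1 mul1r.
have -> : m = m.-1.+1 by rewrite prednK// subn_gt0 ltn_neqAle eq_sym kl'.
under eq_unit_integral do rewrite -[_ * _ * _]addr0.
under [X in _ + D * X]eq_unit_integral do rewrite -[_ * _ * _]addr0.
by rewrite unit_integral_cos unit_integral_sin !mulr0 mul0r !addr0.
Qed.

(** Frequencies start at 1: all the functions expanded have zero mean. Subsums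
    are obtained by setting coefficients to 0. *)
Definition trig_sum (n : nat) (c d : nat -> R) x : R :=
  \sum_(k < n) harmonic (c k) (d k) k.+1 x.

Lemma bm_trig_sum n c d : bounded_measurable (trig_sum n c d).
Proof. by apply: bm_sum => k; exact: bm_harmonic. Qed.

Lemma trig_sum_sqr_integral n c d :
  unit_integral (fun x => trig_sum n c d x ^+ 2) =
  (\sum_(k < n) (c k ^+ 2 + d k ^+ 2)) / 2.
Proof.
have bh k : bounded_measurable (fun x =>
    harmonic (c k) (d k) k.+1 x * trig_sum n c d x).
  by apply: bmM; [exact: bm_harmonic|exact: bm_trig_sum].
under eq_unit_integral do rewrite expr2 {1}/trig_sum mulr_suml.
rewrite unit_integral_sum// mulr_suml; apply: eq_bigr => k _.
under eq_unit_integral do rewrite mulr_sumr.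
rewrite unit_integral_sum; last by move=> l; apply: bmM; exact: bm_harmonic.
under eq_bigr do rewrite unit_integral_harmonicM.
rewrite (bigD1 k)//= eqxx mul1r big1 ?addr0 -?expr2// => l /negbTE.
by rewrite eq_sym -val_eqE /= => ->; rewrite mul0r.
Qed.

Definition cos_coef f (k : nat) :=
  unit_integral (fun x => f x * cos (2 * pi * k%:R * x)).

Definition sin_coef f (k : nat) :=
  unit_integral (fun x => f x * sin (2 * pi * k%:R * x)).

(** Expand the integral of the square of f minus the trigonometric sum with
    the coefficients of f. *)
Lemma bessel f n : bounded_measurable f ->
  \sum_(k < n) (cos_coef f k.+1 ^+ 2 + sin_coef f k.+1 ^+ 2) <=
  unit_integral (fun x => f x ^+ 2) / 2.
Proof.
move=> bf.
pose c k := 2 * cos_coef f k.+1; pose d k := 2 * sin_coef f k.+1.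
set S := \sum_(k < n) _.
have bP := bm_trig_sum n c d.
have : 0 <= unit_integral (fun x => (f x - trig_sum n c d x) ^+ 2).
  by apply: unit_integral_ge0 => x _; exact: sqr_ge0.
have -> : unit_integral (fun x => (f x - trig_sum n c d x) ^+ 2) =
   unit_integral (fun x => f x ^+ 2) -
   2 * unit_integral (fun x => f x * trig_sum n c d x) +
   unit_integral (fun x => trig_sum n c d x ^+ 2).
  have b2 g : bounded_measurable g -> bounded_measurable (fun x => g x ^+ 2).
    by move=> bg; under eq_fun do rewrite expr2; exact: bmM.
  have bff := b2 _ bf; have bPP := b2 _ bP; have bfP := bmM bf bP.
  have b2fP := bmZ 2 bfP; have bD := bmB bff b2fP.
  rewrite -unit_integralZ// -unit_integralB// -unit_integralD//.
  by apply: eq_unit_integral => x _; ring.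
have -> : unit_integral (fun x => f x * trig_sum n c d x) = 2 * S.
  under eq_unit_integral do rewrite mulr_sumr.
  rewrite unit_integral_sum; last by move=> k; apply: bmM => //; exact: bm_harmonic.
  rewrite mulr_sumr; apply: eq_bigr => k _.
  transitivity (c k * cos_coef f k.+1 + d k * sin_coef f k.+1); last first.
    by rewrite /c /d; ring.
  have bc : bounded_measurable (fun x => f x * cos (2 * pi * k.+1%:R * x)).
    by apply: bmM => //; exact: bm_cos.
  have bs : bounded_measurable (fun x => f x * sin (2 * pi * k.+1%:R * x)).
    by apply: bmM => //; exact: bm_sin.
  rewrite -!unit_integralZ -?unit_integralD//; try exact: bmZ.
  by apply: eq_unit_integral => x _; rewrite /harmonic; ring.
rewrite trig_sum_sqr_integral.
have -> : \sum_(k < n) (c k ^+ 2 + d k ^+ 2) = 4 * S.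
  by rewrite mulr_sumr; apply: eq_bigr => k _; rewrite /c /d; ring.
by lra.
Qed.

Lemma riemann_lebesgue f : bounded_measurable f ->
  (cos_coef f k @[k --> \oo] --> 0) /\ (sin_coef f k @[k --> \oo] --> 0).
Proof.
move=> bf.
pose u k := cos_coef f k.+1 ^+ 2 + sin_coef f k.+1 ^+ 2.
have u0 k : 0 <= u k by rewrite addr_ge0 ?sqr_ge0.
have : u @ \oo --> 0.
  apply: cvg_series_cvg_0; apply: nondecreasing_is_cvgn.
    by apply: nondecreasing_series => k _ _; exact: u0.
  exists (unit_integral (fun x => f x ^+ 2) / 2) => _ [n _ <-].
  by rewrite /series /= big_mkord; exact: bessel.
move=> /cvgrPdist_lt ucvg.
by split; rewrite -cvg_shiftS; apply/cvgrPdist_lt => e e0; have := ucvg (e ^+ 2);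
  rewrite exprn_gt0// => /(_ isT); apply: filterS => k;
  rewrite !sub0r !normrN (ger0_norm (u0 _)) -[`|_| < e]ltr_sqr ?nnegrE ?(ltW e0)//;
  rewrite real_normK ?num_real//; apply: le_lt_trans; rewrite /u ?lerDl ?lerDr sqr_ge0.
Qed.

(** * Pointwise convergence of the Fourier series of a primitive *)

Lemma derive_within_continuous f F a b :
  (forall x : R, a <= x <= b -> is_derive x 1 F (f x)) ->
  {within `[a, b], continuous F}.
Proof.
move=> dF; apply: derivable_within_continuous => x; rewrite in_itv /=.
by move=> /dF[].
Qed.

Lemma bm_derive f F : (forall x : R, 0 <= x <= 1 -> is_derive x 1 F (f x)) ->
  bounded_measurable F.
Proof. by move=> /derive_within_continuous/bm_continuous. Qed.

(** Starting the integral at -1 makes the primitive differentiable on both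
    sides at 0 and 1, so that no one-sided derivatives are needed. *)
Lemma mean_zero_primitive f : continuous f -> unit_integral f = 0 ->
  exists F, [/\ forall x : R, 0 <= x <= 1 -> is_derive x 1 F (f x),
                F 0 = F 1 & unit_integral F = 0].
Proof.
move=> cf f0.
pose H (x : R) := \int[leb]_(t in `[-1, x]) f t.
have dH (x : R) : 0 <= x <= 1 -> is_derive x 1 H (f x).
  move=> /andP[x0 x1].
  have x2 : x < 2 by rewrite (le_lt_trans x1)// ltr1n.
  have xN1 : -1 < x by rewrite (lt_le_trans _ x0)// ltrN10.
  have [h1 h2] :=
    continuous_FTC1_closed x2 (continuous_itv_integrable (-1) 2 cf) xN1 (cf x).
  by split; [exact: h1|rewrite -h2 derive1E].
have bH := bm_derive dH.
exists (fun x => H x - unit_integral H); split.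
- move=> x xI; have h := dH x xI.
  by apply: is_derive_eq; rewrite subr0.
- have := Rintegral_derive ler01 cf dH; rewrite -/(unit_integral f) f0.
  by move=> /eqP; rewrite eq_sym subr_eq0 => /eqP ->.
- by rewrite unit_integralB ?unit_integral_cst ?subrr//; exact: bm_cst.
Qed.

(** The mean value theorem gives y cos y <= sin y; used at y = x / 2 together
    with sin x = 2 sin (x / 2) cos (x / 2) it yields
    sin x >= x (1 + cos x) / 2. *)
Lemma sin_ge_half (x : R) : 0 <= x <= pi / 2 -> x / 2 <= sin x.
Proof.
move=> /andP[x0 xpi].
have key (y : R) : 0 <= y <= pi / 2 -> y * cos y <= sin y.
  move=> /andP[y0 ypi].
  have cs : {within `[0, y], continuous (@sin R)}.
    exact/continuous_subspaceT/continuous_sin.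
  have [c] := MVT_segment y0 (fun z _ => is_derive_sin z) cs.
  rewrite in_itv /= => /andP[c0 cy]; rewrite sin0 !subr0 => ->.
  rewrite mulrC ler_wpM2r//.
  have ypi' : y <= pi by rewrite (le_trans ypi)// ler_pdivrMr// ler_peMr ?pi_ge0// ler1n.
  move: cy; rewrite le_eqVlt => /predU1P[->//|cy].
  by rewrite ltW// ltr_cos ?in_itv /= ?c0 ?y0 ?ypi' ?(le_trans (ltW cy)).
have x2 : 0 <= x / 2 <= pi / 2 by apply/andP; split; lra.
have xE : x = x / 2 + x / 2 by field.
have sxE : sin x = 2 * (sin (x / 2) * cos (x / 2)).
  by rewrite {1}xE sinD; ring.
have cxE : cos x = 2 * cos (x / 2) ^+ 2 - 1.
  by rewrite {1}xE cosD -!expr2 sin2cos2; ring.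
have cx : 0 <= cos x.
  apply: cos_ge0_pihalf; rewrite xpi (le_trans _ x0)//.
  by rewrite oppr_le0 divr_ge0// pi_ge0.
have cx2 : 0 <= cos (x / 2).
  apply: cos_ge0_pihalf; move/andP: x2 => [h ->].
  by rewrite (le_trans _ h)// oppr_le0 divr_ge0// pi_ge0.
have := ler_wpM2r cx2 (key _ x2); rewrite sxE => h.
have h3 : 0 <= x * cos x by rewrite mulr_ge0.
have E : x / 2 * cos (x / 2) * cos (x / 2) = x / 4 * (cos x + 1).
  by rewrite cxE; field.
move: h; rewrite E; lra.
Qed.

Lemma primitive_lipschitz f F (M x y : R) :
  (forall x : R, 0 <= x <= 1 -> is_derive x 1 F (f x)) ->
  (forall x, 0 <= x <= 1 -> `|f x| <= M) ->
  0 <= x <= 1 -> 0 <= y <= 1 -> `|F y - F x| <= M * `|y - x|.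
Proof.
move=> dF fM; wlog xy : x y / x <= y.
  move=> h xI yI; have [|/ltW] := leP x y; first by move=> /h; exact.
  by rewrite distrC [`|y - x|]distrC => /h; exact.
move=> /andP[x0 x1] /andP[y0 y1].
have dF' (z : R) : x <= z <= y -> is_derive z 1 F (f z).
  by move=> /andP[xz zy]; apply: dF; rewrite (le_trans x0)// (le_trans zy).
have dF'' (z : R) : z \in `]x, y[ -> is_derive z 1 F (f z).
  by rewrite in_itv /= => /andP[/ltW xz /ltW zy]; apply: dF'; rewrite xz.
have [c] := MVT_segment xy dF'' (derive_within_continuous dF').
rewrite in_itv /= => /andP[xc cy] ->; rewrite normrM ler_wpM2r// fM//.
by rewrite (le_trans x0)// (le_trans cy).
Qed.

(** Up to a constant, |sin (pi u)| is the distance of u to the integers.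
    When y - x > 1/2 the short way from y to x goes through the endpoints,
    where F takes the same value. *)
Lemma periodic_primitive_le_sin f F (M x y : R) :
  (forall x : R, 0 <= x <= 1 -> is_derive x 1 F (f x)) -> F 0 = F 1 ->
  (forall x, 0 <= x <= 1 -> `|f x| <= M) ->
  0 <= x <= 1 -> 0 <= y <= 1 -> `|F y - F x| <= M * `|sin (pi * (y - x))|.
Proof.
move=> dF F01 fM; wlog xy : x y / x <= y.
  move=> h xI yI; have [|/ltW] := leP x y; first by move=> /h; exact.
  rewrite distrC -[y - x]opprB mulrN sinN normrN => /h; exact.
move=> xI yI; have lip := primitive_lipschitz dF fM.
have /andP[x0 x1] := xI; have /andP[y0 y1] := yI.
have M0 : 0 <= M by apply: le_trans (fM x xI).
have pi2 := pi_ge2 R.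
have sinpi2 (u : R) : 0 <= u <= 2^-1 -> u <= `|sin (pi * u)|.
  move=> /andP[u0 u1]; apply: le_trans (ler_norm _).
  apply: le_trans (_ : pi * u / 2 <= _); last first.
    by apply: sin_ge_half; rewrite mulr_ge0 ?pi_ge0//= ler_wpM2l ?pi_ge0.
  by rewrite ler_pdivlMr// mulrC ler_wpM2r.
have [u1|u1] := leP (y - x) 2^-1.
  rewrite (le_trans (lip x y xI yI))// ler_wpM2l//.
  by rewrite ger0_norm ?subr_ge0// sinpi2// subr_ge0 xy.
have -> : `|sin (pi * (y - x))| = `|sin (pi * (1 - (y - x)))|.
  rewrite [in RHS](_ : pi * _ = pi - pi * (y - x)); last by ring.
  by rewrite [in RHS]sinB sinpi cospi mul0r sub0r mulN1r opprK.
have -> : F y - F x = (F y - F 1) + (F 0 - F x) by rewrite F01; ring.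
rewrite (le_trans (ler_normD _ _))//.
have I0 : 0 <= (0 : R) <= 1 by rewrite lexx ler01.
have I1 : 0 <= (1 : R) <= 1 by rewrite lexx ler01.
apply: (le_trans (lerD (lip 1 y I1 yI) (lip x 0 xI I0))).
rewrite -mulrDr ler_wpM2l//; apply: le_trans (sinpi2 _ _); last by apply/andP; split; lra.
by rewrite ler0_norm ?subr_le0// ler0_norm ?subr_le0//; lra.
Qed.

Definition dirichlet (n : nat) (u : R) : R :=
  1 + 2 * \sum_(k < n) cos (2 * pi * k.+1%:R * u).

(** The closed form of the Dirichlet kernel, multiplied out so that it also
    holds where sin (pi u) vanishes. *)
Lemma dirichletE n (u : R) :
  dirichlet n u * sin (pi * u) = sin (2 * pi * n%:R * u + pi * u).
Proof.
elim: n => [|n IH].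
  by rewrite /dirichlet big_ord0 mulr0 addr0 mul1r mulr0 mul0r add0r.
have -> : dirichlet n.+1 u = dirichlet n u + 2 * cos (2 * pi * n.+1%:R * u).
  by rewrite /dirichlet big_ord_recr /=; ring.
rewrite mulrDl IH.
have -> : 2 * pi * n%:R * u + pi * u = 2 * pi * n.+1%:R * u - pi * u.
  by rewrite -natr1; ring.
by rewrite sinB sinD; ring.
Qed.

Lemma bm_dirichlet n (x : R) : bounded_measurable (fun y => dirichlet n (y - x)).
Proof.
apply: bmD; [exact: bm_cst|apply/bmZ/bm_sum => k].
by have := bm_cos_affine (2 * pi * k.+1%:R) (- (2 * pi * k.+1%:R * x));
  under eq_fun do rewrite -mulrBr.
Qed.

Lemma unit_integral_dirichlet n (x : R) :
  unit_integral (fun y => dirichlet n (y - x)) = 1.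
Proof.
have b k : bounded_measurable (fun y : R => cos (2 * pi * k.+1%:R * (y - x))).
  by have := bm_cos_affine (2 * pi * k.+1%:R) (- (2 * pi * k.+1%:R * x));
  under eq_fun do rewrite -mulrBr.
rewrite /dirichlet unit_integralD ?unit_integral_cst ?unit_integralZ; last 3 first.
- by apply: bm_sum => k; exact: b.
- exact: bm_cst.
- by apply/bmZ/bm_sum => k; exact: b.
rewrite unit_integral_sum; last by move=> k; exact: b.
rewrite big1 ?mulr0 ?addr0// => k _.
by under eq_unit_integral do rewrite mulrBr; exact: unit_integral_cos.
Qed.

Definition partial_fourier F n :=
  trig_sum n (fun k => 2 * cos_coef F k.+1) (fun k => 2 * sin_coef F k.+1).

Lemma partial_fourier_dirichlet F n (x : R) :
  bounded_measurable F -> unit_integral F = 0 ->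
  partial_fourier F n x = unit_integral (fun y => F y * dirichlet n (y - x)).
Proof.
move=> bF F0.
have bc k : bounded_measurable (fun y => F y * cos (2 * pi * k.+1%:R * y)).
  by apply: bmM => //; exact: bm_cos.
have bs k : bounded_measurable (fun y => F y * sin (2 * pi * k.+1%:R * y)).
  by apply: bmM => //; exact: bm_sin.
pose c k := 2 * cos (2 * pi * k.+1%:R * x) : R.
pose s k := 2 * sin (2 * pi * k.+1%:R * x) : R.
have bcs k : bounded_measurable (fun y => c k * (F y * cos (2 * pi * k.+1%:R * y)) +
   s k * (F y * sin (2 * pi * k.+1%:R * y))) by apply: bmD; exact: bmZ.
transitivity (unit_integral (fun y => F y + \sum_(k < n)
  (c k * (F y * cos (2 * pi * k.+1%:R * y)) +
   s k * (F y * sin (2 * pi * k.+1%:R * y))))); last first.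
  apply: eq_unit_integral => y _; rewrite /dirichlet [RHS]mulrDr mulr1; congr (_ + _).
  rewrite mulrCA mulr_sumr mulr_sumr; apply: eq_bigr => k _.
  by rewrite mulrBr cosB /c /s; ring.
rewrite unit_integralD ?F0 ?add0r//; last by apply: bm_sum => k; exact: bcs.
rewrite unit_integral_sum; last by move=> k; exact: bcs.
apply: eq_bigr => k _; have bck := bc k; have bsk := bs k.
have bck' := bmZ (c k) bck; have bsk' := bmZ (s k) bsk.
by rewrite unit_integralD// !unit_integralZ// /harmonic /c /s /cos_coef /sin_coef; ring.
Qed.

(** The inverse is z times a real power of z^2, which handles z = 0 with the
    convention 0^-1 = 0. *)
Lemma measurable_invr : measurable_fun setT (fun z : R => z^-1).
Proof.
have -> : (fun z : R => z^-1) = (fun z => z * (z ^+ 2) `^ (-1)).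
  apply/funext => z; rewrite powR_inv1 ?sqr_ge0//.
  by have [->|z0] := eqVneq z 0; [rewrite invr0 mul0r|field].
apply: measurable_funM => //.
apply: (@measurableT_comp _ _ _ _ _ _ (@powR R ^~ (-1))) => //.
Qed.

(** Dirichlet's argument. The difference of the partial sum and F x is the
    integral of (F y - F x) times the kernel. As F is Lipschitz on the circle,
    the quotient q of F y - F x by sin (pi (y - x)) is bounded, and what is
    left are Fourier coefficients of two bounded functions, which tend to 0 by
    the Riemann-Lebesgue lemma. *)
Lemma partial_fourier_cvg f F (x : R) :
  (forall x : R, 0 <= x <= 1 -> is_derive x 1 F (f x)) -> F 0 = F 1 ->
  continuous f -> unit_integral F = 0 -> 0 <= x <= 1 ->
  partial_fourier F n x @[n --> \oo] --> F x.
Proof.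
move=> dF F01 cf F0 xI.
have bF := bm_derive dF.
have [_ [M fM]] := bm_continuousT cf.
have fM' (z : R) : 0 <= z <= 1 -> `|f z| <= M.
  by move=> zI; apply: fM; rewrite /= in_itv.
have Fsin y := periodic_primitive_le_sin dF F01 fM' xI (y := y).
pose q y := (F y - F x) / sin (pi * (y - x)).
have bdF : bounded_measurable (fun y => F y - F x) by apply: bmB => //; exact: bm_cst.
have bsin : bounded_measurable (fun y : R => sin (pi * (y - x))).
  by have := bm_sin_affine pi (- (pi * x)); under eq_fun do rewrite -mulrBr.
have bcos : bounded_measurable (fun y : R => cos (pi * (y - x))).
  by have := bm_cos_affine pi (- (pi * x)); under eq_fun do rewrite -mulrBr.
have bq : bounded_measurable q.
  split.
    apply: measurable_funM; first exact: bdF.1.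
    apply: measurableT_comp measurable_invr _.
    exact: bsin.1.
  exists M => y; rewrite /= in_itv => /Fsin; rewrite /q normrM normfV.
  have [->|s0] := eqVneq (sin (pi * (y - x))) 0.
    by rewrite normr0 mulr0 invr0 mulr0 => _; apply: le_trans (fM' x xI).
  by rewrite ler_pdivrMr ?normr_gt0.
have b1 := bmM bq bcos; have b2 := bmM bq bsin.
have [c1 s1] := riemann_lebesgue b1; have [c2 s2] := riemann_lebesgue b2.
pose h1 y := q y * cos (pi * (y - x)); pose h2 y := q y * sin (pi * (y - x)).
have E n : partial_fourier F n x - F x =
   cos (2 * pi * n%:R * x) * (sin_coef h1 n + cos_coef h2 n)
   + sin (2 * pi * n%:R * x) * (sin_coef h2 n - cos_coef h1 n).
  have bD := bm_dirichlet n x.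
  have -> : F x = unit_integral (fun y => F x * dirichlet n (y - x)).
    by rewrite unit_integralZ// unit_integral_dirichlet mulr1.
  rewrite partial_fourier_dirichlet// -unit_integralB; last 2 first.
  - exact: bmM.
  - exact: bmZ.
  set C := cos _; set S := sin _.
  have w1 := bmM b1 (bm_sin (2 * pi * n%:R)); have w2 := bmM b2 (bm_cos (2 * pi * n%:R)).
  have w3 := bmM b2 (bm_sin (2 * pi * n%:R)); have w4 := bmM b1 (bm_cos (2 * pi * n%:R)).
  rewrite /sin_coef /cos_coef -unit_integralD// -unit_integralB//.
  rewrite -!unit_integralZ//; last 2 first.
  - exact: bmB.
  - exact: bmD.
  rewrite -unit_integralD; last 2 first.
  - by apply/bmZ/bmD.
  - by apply/bmZ/bmB.
  apply: eq_unit_integral => y yI.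
  have -> : F y * dirichlet n (y - x) - F x * dirichlet n (y - x) =
     q y * (dirichlet n (y - x) * sin (pi * (y - x))).
    rewrite /q; have [s0|s0] := eqVneq (sin (pi * (y - x))) 0; last by field.
    move: yI; rewrite /= in_itv => /Fsin; rewrite s0 normr0 mulr0 normr_le0.
    by rewrite invr0 !mulr0 -mulrBl => /eqP ->; rewrite mul0r.
  rewrite dirichletE /h1 /h2.
  have -> : 2 * pi * n%:R * (y - x) + pi * (y - x) =
     (2 * pi * n%:R * y - 2 * pi * n%:R * x) + pi * (y - x) by ring.
  by rewrite sinD sinB cosB -/C -/S; ring.
apply/cvgrPdist_le => e e0.
have e4 : 0 < e / 4 by rewrite divr_gt0.
move/cvgrPdist_le : c1 => /(_ _ e4) c1; move/cvgrPdist_le : s1 => /(_ _ e4) s1.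
move/cvgrPdist_le : c2 => /(_ _ e4) c2; move/cvgrPdist_le : s2 => /(_ _ e4) s2.
near=> n; rewrite distrC E.
have c1n : `|cos_coef h1 n| <= e / 4 by rewrite -normrN -sub0r; near: n; exact: c1.
have s1n : `|sin_coef h1 n| <= e / 4 by rewrite -normrN -sub0r; near: n; exact: s1.
have c2n : `|cos_coef h2 n| <= e / 4 by rewrite -normrN -sub0r; near: n; exact: c2.
have s2n : `|sin_coef h2 n| <= e / 4 by rewrite -normrN -sub0r; near: n; exact: s2.
have le1 (u v : R) : `|u| <= 1 -> `|u * v| <= `|v|.
  by move=> u1; rewrite normrM ler_piMl.
rewrite (le_trans (ler_normD _ _))//.
apply: le_trans (lerD (le1 _ _ (cos_max _)) (le1 _ _ (sin_max _))) _.
apply: le_trans (lerD (ler_normD _ _) (ler_normB _ _)) _.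
lra.
Unshelve. all: by end_near. Qed.

(** * A weak-type Hausdorff-Young inequality *)

Definition level_above (lam : R) g : set R := I01 `&` [set x | lam < `|g x|].

Lemma measurable_level_above g (lam : R) : measurable_fun I01 g ->
  measurable (level_above lam g).
Proof.
move=> mg.
have mng : measurable_fun I01 (fun x => `|g x|) by exact: measurableT_comp.
have := mng (measurable_itv `[0, 1]) _ (measurable_itv `]lam, +oo[).
rewrite (_ : (fun x => `|g x|) @^-1` _ = [set x | lam < `|g x|])//.
by apply/seteqP; split => x /=; rewrite in_itv /= andbT.
Qed.

(** Chebyshev's inequality, with the set where g is large controlled through
    another function h that is large there. *)
Lemma chebyshev_unit g h (lam mu : R) : 0 < mu ->
  bounded_measurable g -> bounded_measurable h ->
  (forall x, I01 x -> lam < `|g x| -> mu <= `|h x|) ->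
  (leb (level_above lam g) <=
   (mu ^- 2 * unit_integral (fun x => h x ^+ 2))%:E)%E.
Proof.
move=> mu0 bg bh gh; set E := level_above lam g.
have mE : measurable E by apply: measurable_level_above; case: bg.
have bE := bm_indic mE.
have finE : (leb E < +oo)%E.
  apply: (@le_lt_trans _ _ (leb I01)); last by rewrite leb_I01 ltry.
  by apply: le_measure; rewrite ?inE//; exact: subIsetl.
have EE : leb E = (unit_integral (\1_E : R -> R))%:E.
  have IE : (\int[leb]_(x in I01) (\1_E x)%:E = leb E)%E.
    by rewrite integral_indic// /E /level_above setIAC setIid.
  by rewrite /unit_integral /Rintegral IE fineK// ge0_fin_numE.
rewrite EE lee_fin -unit_integralZ; last by under eq_fun do rewrite expr2; exact: bmM.
have bh2 : bounded_measurable (fun x => mu ^- 2 * h x ^+ 2).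
  by apply: bmZ; under eq_fun do rewrite expr2; exact: bmM.
apply: le_unit_integral => // x xI; rewrite indicE.
have [xE|_] := boolP (x \in E); last by rewrite mulr_ge0 ?invr_ge0 ?sqr_ge0.
move: xE; rewrite inE => -[_ /= /(gh x xI) muh].
rewrite mulrC ler_pdivlMr ?exprn_gt0// mul1r -[leRHS]real_normK ?num_real//.
by rewrite ler_sqr ?nnegrE ?(ltW mu0).
Qed.

Definition amplitude (c d : nat -> R) (k : nat) : R := Num.sqrt (c k ^+ 2 + d k ^+ 2).

Lemma harmonic_le_amplitude c d k n x : `|harmonic (c k) (d k) n x| <= amplitude c d k.
Proof.
rewrite /harmonic; set C := cos _; set S := sin _.
rewrite -sqrtr_sqr ler_wsqrtr//.
have CS : C ^+ 2 + S ^+ 2 = 1 by exact: cos2Dsin2.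
rewrite -[leRHS]mulr1 -CS -subr_ge0.
rewrite (_ : _ - _ = (c k * S - d k * C) ^+ 2) ?sqr_ge0//.
by ring.
Qed.

(** The weak-type form of the Hausdorff-Young inequality, for trigonometric
    sums. Split the harmonics at the amplitude A: those above A contribute at
    most lam / 2 uniformly, by comparing the l^1 and l^s' norms, so where the
    whole sum exceeds lam the rest exceeds lam / 2. The rest is controlled in
    L^2 by orthogonality, since s' <= 2. Interpolation theory is avoided
    because only one level lam is considered at a time. *)
Lemma weak_hausdorff_young (s s' tau lam : R) n c d :
  2 <= s -> s' = s / (s - 1) -> 0 < tau -> 0 < lam ->
  \sum_(k < n) amplitude c d k `^ s' <= tau `^ s' ->
  (leb (level_above lam (trig_sum n c d)) <=
    ((2 * tau / lam) `^ s)%:E)%E.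
Proof.
move=> s2 s'E tau0 lam0 ampT.
have s10 : 0 < s - 1 by lra.
have s1n0 : s - 1 != 0 by rewrite gt_eqF.
have s's : (s - 1) * (s' - 1) = 1 by rewrite s'E; field.
have s2s : (s - 1) * (2 - s') = s - 2 by rewrite s'E; field.
have s'1 : 1 < s' by rewrite -subr_gt0 -(pmulr_rgt0 _ s10) s's.
have s'2 : s' <= 2 by rewrite -subr_ge0 -(pmulr_rge0 _ s10) s2s subr_ge0.
have s'0 : 0 < s' by exact: lt_trans s'1.
pose T := tau `^ s'; pose z := 2 * T / lam.
have T0 : 0 < T by exact: powR_gt0.
have z0 : 0 < z by rewrite divr_gt0 ?mulr_gt0.
(* the threshold that bounds the sum of the large harmonics by lam / 2 *)
pose A := z `^ (s - 1).
have A0 : 0 < A by exact: powR_gt0.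
pose big k := A < amplitude c d k.
pose mask (b : bool) (u : nat -> R) k := if big k == b then u k else 0.
have amp0 k : 0 <= amplitude c d k by exact: sqrtr_ge0.
have splitE x : trig_sum n c d x =
    trig_sum n (mask true c) (mask true d) x + trig_sum n (mask false c) (mask false d) x.
  rewrite /trig_sum -big_split; apply: eq_bigr => k _ /=.
  by rewrite /harmonic /mask; case: (big k); rewrite /= !mul0r ?addr0 ?add0r.
have bigle x : `|trig_sum n (mask true c) (mask true d) x| <= lam / 2.
  apply: le_trans (ler_norm_sum _ _ _) _.
  have lamE : z^-1 * T = lam / 2.
    by rewrite /z; field; rewrite !gt_eqF.
  rewrite -lamE.
  apply: (@le_trans _ _ (\sum_(k < n) z^-1 * amplitude c d k `^ s')); last first.
    by rewrite -mulr_sumr ler_wpM2l ?invr_ge0 ?(ltW z0).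
  apply: ler_sum => k _; have [bk|bk] := boolP (big k); last first.
    rewrite /harmonic /mask (negbTE bk) /= !mul0r addr0 normr0.
    by rewrite mulr_ge0 ?powR_ge0// invr_ge0 ltW.
  rewrite {1}/mask {1}/mask bk /=; apply: le_trans (harmonic_le_amplitude _ _ _ _ _) _.
  set r := amplitude c d k in bk *.
  have r0 : 0 < r by exact: lt_trans bk.
  rewrite ler_pdivlMl// -(mulr_powRB1 (ltW r0) s'0) mulrC ler_wpM2l ?(ltW r0)//.
  have -> : z = A `^ (s' - 1).
    by rewrite /A -powRrM s's powRr1// ltW.
  by apply: ge0_ler_powR; rewrite ?nnegrE ?ltW ?subr_gt0.
have b2 := bm_trig_sum n (mask false c) (mask false d).
have l20 : 0 < lam / 2 by rewrite divr_gt0.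
apply: le_trans (chebyshev_unit l20 (bm_trig_sum n c d) b2 _) _.
  move=> x _; rewrite splitE => lt.
  have := ler_normD (trig_sum n (mask true c) (mask true d) x)
    (trig_sum n (mask false c) (mask false d) x).
  have := bigle x; lra.
rewrite lee_fin trig_sum_sqr_integral.
have smallle : \sum_(k < n) (mask false c k ^+ 2 + mask false d k ^+ 2) <=
    z `^ (s - 2) * T.
  apply: (@le_trans _ _ (\sum_(k < n) z `^ (s - 2) * amplitude c d k `^ s')); last first.
    by rewrite -mulr_sumr ler_wpM2l ?powR_ge0.
  apply: ler_sum => k _; rewrite /mask; have [bk|bk] := boolP (big k) => /=.
    by rewrite expr0n /= addr0 mulr_ge0 ?powR_ge0.
  have -> : c k ^+ 2 + d k ^+ 2 = amplitude c d k ^+ 2.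
    by rewrite sqr_sqrtr// addr_ge0 ?sqr_ge0.
  have := amp0 k; move: bk; rewrite /big -leNgt; set r := amplitude c d k.
  move=> rA; rewrite le_eqVlt => /predU1P[<-|r0].
    by rewrite expr0n /= mulr_ge0 ?powR_ge0.
  have -> : r ^+ 2 = r `^ (2 - s') * r `^ s'.
    by rewrite -powRD ?subrK ?powR_mulrn ?(ltW r0)// (gt_eqF r0) implybT.
  rewrite ler_wpM2r ?powR_ge0//.
  have -> : z `^ (s - 2) = A `^ (2 - s') by rewrite /A -powRrM s2s.
  by apply: ge0_ler_powR; rewrite ?nnegrE ?(ltW r0) ?(ltW A0) ?subr_ge0.
apply: (@le_trans _ _ ((lam / 2) ^- 2 * (z `^ (s - 2) * T / 2))).
  by rewrite ler_wpM2l ?invr_ge0 ?sqr_ge0// ler_wpM2r.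
have zE : z `^ (s - 1) = z * z `^ (s - 2).
  by rewrite -(mulr_powRB1 (ltW z0) s10); congr (_ * powR z _); ring.
have -> : (lam / 2) ^- 2 * (z `^ (s - 2) * T / 2) = z `^ (s - 1) / lam.
  by rewrite zE {2}/z; field; rewrite gt_eqF.
have s0 : 0 < s by lra.
have q0 : 0 < 2 / lam by rewrite divr_gt0.
have -> : (2 * tau / lam) `^ s = 2 / lam * z `^ (s - 1).
  rewrite mulrAC powRM ?(ltW q0) ?(ltW tau0)//.
  rewrite -(mulr_powRB1 (ltW q0) s0) -mulrA; congr (_ * _).
  rewrite /z mulrAC [in RHS]powRM ?(ltW q0) ?(ltW T0)// /T -powRrM; congr (_ * powR _ _).
  by rewrite s'E; field.
by rewrite mulrC ler_wpM2r ?powR_ge0// ler_peMl ?invr_ge0 ?(ltW lam0)// ler1n.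
Qed.

(** A point where |h| > lam eventually lies in all the sets where
    |g n| > lam; continuity of the measure along increasing unions
    concludes. *)
Lemma level_above_pointwise_limit (g : nat -> R -> R) (h : R -> R) (lam : R)
    (B : \bar R) :
  (forall n, measurable_fun I01 (g n)) -> measurable_fun I01 h ->
  (forall x, I01 x -> g n x @[n --> \oo] --> h x) ->
  (forall n, leb (level_above lam (g n)) <= B)%E ->
  (leb (level_above lam h) <= B)%E.
Proof.
move=> mg mh gh gB.
pose E n := level_above lam (g n).
pose G m := \bigcap_(n in [set n | (m <= n)%N]) E n.
have mE n : measurable (E n) by exact: measurable_level_above.
have mG m : measurable (G m) by apply: bigcap_measurable => //; exists m => /=.
have mUG : measurable (\bigcup_m G m) by apply: bigcup_measurable => m _; exact: mG.
have ndG : {homo G : n m / (n <= m)%N >-> (n <= m)%O}.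
  move=> n m nm; apply/subsetPset => x Gx k /= mk; apply: Gx => /=.
  exact: leq_trans mk.
have : (leb (\bigcup_m G m) <= B)%E.
  have cv := nondecreasing_cvg_mu (mu := leb) mG mUG ndG.
  rewrite -(cvg_lim _ cv)//; apply: lime_le.
    by apply/cvg_ex; eexists; exact: cv.
  apply: nearW => m /=; apply: le_trans (gB m).
  by apply: le_measure; rewrite ?inE; [exact: mG|exact: mE|move=> x Gx; apply: Gx => /=].
apply: le_trans; apply: le_measure; rewrite ?inE; [exact: measurable_level_above|exact: mUG|].
move=> x [xI /= hx].
have : `|g n x| @[n --> \oo] --> `|h x| by apply: cvg_norm; exact: gh.
move=> /cvgr_gt => /(_ _ hx) [m _ mh']; exists m => // n /= mn; split => //.
exact: mh'.
Qed.

Lemma weak_type_primitive (s s' tau lam : R) f F :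
  2 <= s -> s' = s / (s - 1) -> 0 < tau -> 0 < lam ->
  (forall x : R, 0 <= x <= 1 -> is_derive x 1 F (f x)) -> F 0 = F 1 ->
  continuous f -> unit_integral F = 0 ->
  (forall n, \sum_(k < n) amplitude (fun k => 2 * cos_coef F k.+1)
     (fun k => 2 * sin_coef F k.+1) k `^ s' <= tau `^ s') ->
  (leb (level_above lam F) <= ((2 * tau / lam) `^ s)%:E)%E.
Proof.
move=> s2 s'E tau0 lam0 dF F01 cf F0 ampT.
apply: (@level_above_pointwise_limit (partial_fourier F)).
- move=> n; by case: (bm_trig_sum n (fun k => 2 * cos_coef F k.+1)
    (fun k => 2 * sin_coef F k.+1)).
- by case: (bm_derive dF).
- by move=> x; rewrite /= in_itv /= => xI; exact: partial_fourier_cvg dF F01 cf F0 xI.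
- by move=> n; exact: (weak_hausdorff_young s2 s'E).
Qed.

Lemma coef_by_parts f F k :
  (forall x : R, 0 <= x <= 1 -> is_derive x 1 F (f x)) -> F 0 = F 1 ->
  continuous f ->
  sin_coef f k.+1 = - (2 * pi * k.+1%:R * cos_coef F k.+1) /\
  cos_coef f k.+1 = 2 * pi * k.+1%:R * sin_coef F k.+1.
Proof.
move=> dF F01 cf; set w := 2 * pi * k.+1%:R.
have bF := bm_derive dF; have bf := bm_continuousT cf.
have cw : cos (w * 1) = 1 :> R by rewrite mulr1 cos_2pi_nat.
have sw : sin (w * 1) = 0 :> R by rewrite mulr1 sin_2pi_nat.
have cF (x : R) : 0 <= x <= 1 -> {for x, continuous F}.
  by move=> /dF[dFx _]; apply/differentiable_continuous/derivable1_diffP.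
have parts (G g : R -> R) : (forall x : R, is_derive x 1 G (g x)) -> continuous g ->
    G 0 = G 1 ->
    unit_integral (fun x => f x * G x) = - unit_integral (fun x => F x * g x).
  move=> dG cg G01.
  have cG (x : R) : {for x, continuous G}.
    by have [dGx _] := dG x; apply/differentiable_continuous/derivable1_diffP.
  have I0 : 0 <= (0 : R) <= 1 by rewrite lexx ler01.
  have I1 : 0 <= (1 : R) <= 1 by rewrite lexx ler01.
  have := @Rintegration_by_parts R F G f g 0 1 ltr01.
  rewrite F01 G01 subrr sub0r -/(unit_integral (fun x => F x * g x)).
  rewrite -/(unit_integral (fun x => f x * G x)) => ->; first by rewrite opprK.
  - exact: continuous_subspaceT.
  - split.
    + move=> x; rewrite in_itv /= => /andP[/ltW x0 /ltW x1].
      by have [] := dF x; rewrite ?x0.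
    + by apply: cvg_at_right_filter; exact: cF.
    + by apply: cvg_at_left_filter; exact: cF.
  - move=> x; rewrite in_itv /= => /andP[/ltW x0 /ltW x1].
    by rewrite derive1E; have [|_ ->] := dF x; rewrite ?x0.
  - exact: continuous_subspaceT.
  - split.
    + by move=> x _; have [] := dG x.
    + by apply: cvg_at_right_filter; exact: cG.
    + by apply: cvg_at_left_filter; exact: cG.
  - by move=> x _; rewrite derive1E; have [_ ->] := dG x.
have dsin (x : R) : is_derive x 1 (fun y => sin (w * y)) (w * cos (w * x)).
  have := is_derive_sin_affine w 0 x; rewrite addr0.
  by under eq_fun do rewrite addr0.
have dcos (x : R) : is_derive x 1 (fun y => cos (w * y)) (- (w * sin (w * x))).
  have := is_derive_cos_affine w 0 x; rewrite addr0.
  by under eq_fun do rewrite addr0.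
have bFc := bmM bF (bm_cos w); have bFs := bmM bF (bm_sin w).
split.
  rewrite /sin_coef (parts _ _ dsin).
  - rewrite /cos_coef -unit_integralZ//; congr (- _).
    by apply: eq_unit_integral => x _; rewrite mulrCA.
  - move=> x; apply: cvgM; first exact: cvg_cst.
    by have [dx _] := dcos x; apply/differentiable_continuous/derivable1_diffP.
  - by rewrite sw mulr0 sin0.
rewrite /cos_coef (parts _ _ dcos).
- rewrite /sin_coef -unit_integralZ// -[LHS]mulN1r -unit_integralZ.
    by apply: eq_unit_integral => x _; ring.
  under eq_fun do rewrite mulrN mulrCA.
  by have := bmZ (-1) (bmZ w bFs); under eq_fun do rewrite mulN1r.
- move=> x; apply: cvgN; apply: cvgM; first exact: cvg_cst.
  by have [dx _] := dsin x; apply/differentiable_continuous/derivable1_diffP.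
- by rewrite cw mulr0 cos0.
Qed.

(** * Mass of a function where its primitive is large *)

(** A primitive is controlled on the unit interval only; precomposing it with
    the projection onto that interval gives a function continuous on the whole
    line. *)
Definition clip (x : R) : R := Num.max 0 (Num.min 1 x).

Lemma clip_itv x : 0 <= clip x <= 1.
Proof. by rewrite /clip le_max lexx /= ge_max ler01 ge_min lexx. Qed.

Lemma clip_id x : 0 <= x <= 1 -> clip x = x.
Proof. by move=> /andP[x0 x1]; rewrite /clip min_r// max_r. Qed.

Lemma continuous_clip : continuous clip.
Proof.
move=> x.
have c1 : {for x, continuous ((cst 1 : R -> R^o) \min id)}.
  by apply: continuous_min; [exact: cvg_cst|exact: cvg_id].
have c0 : {for x, continuous (cst 0 : R -> R^o)} by exact: cvg_cst.
exact: (continuous_max c0 c1).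
Qed.

Lemma alternating_same_sign f g a b s :
  (forall u v, g u * g v < 0 -> f u * f v < 0) ->
  alternating g a b s -> alternating f a b s.
Proof.
move=> gf /andP[sI so]; rewrite /alternating sI /=.
by apply: sub_sorted so => u v /andP[-> /gf].
Qed.

(** Without a sign change the integral of |f| would be |F 1 - F 0| = 0. *)
Lemma sign_changes_gt0 f F N : continuous f ->
  (forall x : R, 0 <= x <= 1 -> is_derive x 1 F (f x)) -> F 0 = F 1 ->
  0 < unit_integral (fun x => `|f x|) -> is_sign_changes f N -> (0 < N)%N.
Proof.
move=> cf dF F01 f0 fN; rewrite lt0n; apply: contraTneq f0 => N0.
rewrite -leNgt /unit_integral (integral_norm_constant_sign ler01 cf dF).
  by rewrite F01 subrr normr0.
apply: no_alternating_pair => s /(size_alternating fN).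
by rewrite N0.
Qed.

(** On the unit interval this is the derivative of lam atan (F / lam). *)
Definition damped f F (lam x : R) : R := f x / (1 + (F (clip x) / lam) ^+ 2).

Lemma damping_gt0 F (lam x : R) : 0 < 1 + (F (clip x) / lam) ^+ 2.
Proof. by rewrite ltr_wpDr ?sqr_ge0. Qed.

Lemma continuous_damped f F (lam : R) : continuous f ->
  (forall x : R, 0 <= x <= 1 -> is_derive x 1 F (f x)) ->
  continuous (damped f F lam).
Proof.
move=> cf dF x; apply: cvgM; first exact: cf.
apply: cvgV; first by rewrite gt_eqF// damping_gt0.
apply: cvgD; first exact: cvg_cst.
have h : (fun x => F (clip x) / lam) x @[x --> x] --> F (clip x) / lam.
  apply: cvgM; last exact: cvg_cst.
  apply: (@continuous_comp _ _ _ clip F); first exact: continuous_clip.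
  have [dFx _] := dF _ (clip_itv x).
  exact/differentiable_continuous/derivable1_diffP.
by under eq_fun do rewrite expr2; rewrite expr2; exact: cvgM.
Qed.

(** The function lam atan (F / lam) is bounded by 2 lam and its derivative has
    the same sign as f, so its total variation is governed by the sign changes
    of f. *)
Lemma damped_mass f F N (lam : R) : 0 < lam -> continuous f ->
  (forall x : R, 0 <= x <= 1 -> is_derive x 1 F (f x)) ->
  is_sign_changes f N ->
  unit_integral (fun x => `|damped f F lam x|) <= 4 * lam * N.+1%:R.
Proof.
move=> lam0 cf dF fN.
pose G x := lam * atan (lam^-1 * F x).
have cg := continuous_damped (lam := lam) cf dF.
have dG (x : R) : 0 <= x <= 1 -> is_derive x 1 G (damped f F lam x).
  move=> xI; have h := dF x xI; rewrite /G.
  have h1 : is_derive x 1 (fun x => lam^-1 * F x) (lam^-1 * f x).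
    by apply: is_derive_eq.
  have h2 := @is_derive1_comp R atan (fun x => lam^-1 * F x) x _ _
    (is_derive1_atan _) h1.
  have h3 : is_derive x 1 (fun y => lam * (atan \o (fun x => lam^-1 * F x)) y)
      (lam * ((1 + (lam^-1 * F x) ^+ 2)^-1 * (lam^-1 * f x))).
    by apply: is_derive_eq.
  apply: is_derive_eq h3 _.
  rewrite /damped (clip_id xI) [F x / lam]mulrC; field.
  by rewrite (gt_eqF lam0) gt_eqF// ltr_wpDr ?sqr_ge0 ?exprn_gt0.
have GB x : 0 <= x <= 1 -> `|G x| <= 2 * lam.
  move=> _; rewrite /G normrM (gtr0_norm lam0) mulrC ler_wpM2r ?(ltW lam0)//.
  have p2 := pihalf_lt2 R.
  rewrite ler_norml (le_trans _ (ltW (atan_gtNpi2 _))) ?lerN2 ?(ltW p2)//=.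
  by rewrite (le_trans (ltW (atan_ltpi2 _))) ?(ltW p2).
have := integral_norm_alternations (K := N) ler01 cg dG GB.
rewrite mulrA -natrM; apply => s /(@alternating_same_sign f) h.
apply: (size_alternating fN); apply: h => u v.
by rewrite mulrACA -invfM pmulr_llt0// invr_gt0 mulr_gt0 ?damping_gt0.
Qed.

(** Where |F| <= lam the damping factor is at least 1/2, so the mass of f there
    is at most twice the damped mass, that is, 8 lam (N + 1) <= 16 lam N.
    The level lam = a / (32 N) makes this half of the total mass a. *)
Lemma level_mass f F N (a : R) : continuous f ->
  (forall x : R, 0 <= x <= 1 -> is_derive x 1 F (f x)) -> F 0 = F 1 ->
  is_sign_changes f N -> a = unit_integral (fun x => `|f x|) -> 0 < a ->
  a / 2 <= unit_integral
    (fun x => `|f x| * \1_(level_above (a / (32 * N%:R)) F) x).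
Proof.
move=> cf dF F01 fN aE a0.
have N0 : (0 < N)%N by apply: (sign_changes_gt0 cf dF F01 _ fN); rewrite -aE.
have NR : 1 <= N%:R :> R by rewrite ler1n.
set lam := a / (32 * N%:R).
have lam0 : 0 < lam by rewrite divr_gt0// mulr_gt0// (lt_le_trans ltr01).
pose g := damped f F lam.
have gle : unit_integral (fun x => `|g x|) <= 4 * lam * N.+1%:R.
  exact: damped_mass lam0 cf dF fN.
have bg : bounded_measurable g by exact/bm_continuousT/continuous_damped.
set E := level_above lam F.
have mE : measurable E by apply: measurable_level_above; case: (bm_derive dF).
have bE := bm_indic mE.
have bf := bm_norm (bm_continuousT cf).
have bfE := bmM bf bE; have bg2 := bmZ 2 (bm_norm bg).
have : unit_integral (fun x => `|f x|) <=
    unit_integral (fun x => `|f x| * \1_E x + 2 * `|g x|).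
  apply: le_unit_integral => //; first exact: bmD.
  move=> x xI; rewrite indicE.
  have [xE|xE] := boolP (x \in E); first by rewrite mulr1 lerDl mulr_ge0.
  rewrite mulr0 add0r /g /damped normrM normfV.
  set D := `|_ + _|; have D2 : D <= 2.
    rewrite /D ger0_norm ?addr_ge0 ?sqr_ge0// -[leRHS]/(1 + 1) lerD2l.
    rewrite clip_id; last by move: xI; rewrite /= in_itv.
    rewrite -real_normK ?num_real// expr_le1// normrM normfV (gtr0_norm lam0).
    rewrite ler_pdivrMr// mul1r leNgt; apply: contraNN xE => Fx.
    by rewrite inE.
  have D0 : 0 < D by rewrite normr_gt0 gt_eqF// damping_gt0.
  by rewrite mulrCA ler_peMr// ler_pdivlMr// mul1r.
rewrite unit_integralD// unit_integralZ; last exact: bm_norm.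
rewrite -aE => h.
have lamN : lam * N%:R = a / 32.
  by rewrite /lam; field; rewrite gt_eqF// (lt_le_trans ltr01).
have : 4 * lam * N.+1%:R <= a / 4.
  rewrite -[N.+1%:R]natr1 (_ : a / 4 = 4 * lam * (N%:R + N%:R)).
    by rewrite ler_wpM2l ?lerD2l// mulr_ge0 ?(ltW lam0).
  by rewrite mulrDr -mulrA lamN; field.
lra.
Qed.

(** * Fourier coefficients and Fourier-Lebesgue norms *)

Lemma fourier_coef_real f (k : nat) : continuous f ->
  fourier_coef (fun x => (f x)%:C) k%:Z = cos_coef f k +i* - sin_coef f k.
Proof.
move=> cf; rewrite /fourier_coef /torus_integral.
have cc : continuous (fun x => f x * cos (2 * pi * k%:R * x)).
  move=> x; apply: cvgM; first exact: cf.
  exact: continuous_cos_linear.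
have cs : continuous (fun x => - (f x * sin (2 * pi * k%:R * x))).
  move=> x; apply: cvgN; apply: cvgM; first exact: cf.
  exact: continuous_sin_linear.
congr (_ +i* _).
  rewrite /cos_coef -Rintegral_torus//; apply: eq_Rintegral => x _.
  by rewrite /expi /= cosN mul0r subr0.
have bs : bounded_measurable (fun x => f x * sin (2 * pi * k%:R * x)).
  by apply: bmM; [exact: bm_continuousT|exact: bm_sin].
rewrite /sin_coef -[RHS]mulN1r -unit_integralZ//.
under [RHS]eq_unit_integral do rewrite mulN1r.
rewrite -Rintegral_torus//; apply: eq_Rintegral => x _.
by rewrite /expi /= sinN mul0r addr0 mulrN.
Qed.

(** The integral of a complex function is defined componentwise, and so is
    the regularity it requires. *)
Definition ccontinuous (h : R -> R[i]) : Prop :=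
  continuous (fun x => complex.Re (h x)) /\ continuous (fun x => complex.Im (h x)).

Lemma torus_integralE h : ccontinuous h -> torus_integral h =
  unit_integral (fun x => complex.Re (h x)) +i* unit_integral (fun x => complex.Im (h x)).
Proof. by move=> [cr ci]; rewrite /torus_integral !Rintegral_torus. Qed.

Lemma ReD (z w : R[i]) : complex.Re (z + w) = complex.Re z + complex.Re w.
Proof. by case: z; case: w. Qed.

Lemma ImD (z w : R[i]) : complex.Im (z + w) = complex.Im z + complex.Im w.
Proof. by case: z; case: w. Qed.

Lemma ccontinuousD (g h : R -> R[i]) : ccontinuous g -> ccontinuous h ->
  ccontinuous (fun x => g x + h x).
Proof.
move=> [gr gi] [hr hi]; split.
  under eq_fun do rewrite ReD; move=> x; apply: cvgD; [exact: gr|exact: hr].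
under eq_fun do rewrite ImD; move=> x; apply: cvgD; [exact: gi|exact: hi].
Qed.

Lemma ccontinuous_sum (I : Type) (r : seq I) (h : I -> R -> R[i]) :
  (forall i, ccontinuous (h i)) -> ccontinuous (fun x => \sum_(i <- r) h i x).
Proof.
move=> ch; elim: r => [|i r IH].
  under eq_fun do rewrite big_nil; by split=> x; exact: cvg_cst.
by under eq_fun do rewrite big_cons; exact: ccontinuousD.
Qed.

Lemma torus_integral_sum (I : Type) (r : seq I) (h : I -> R -> R[i]) :
  (forall i, ccontinuous (h i)) ->
  torus_integral (fun x => \sum_(i <- r) h i x) = \sum_(i <- r) torus_integral (h i).
Proof.
move=> ch; elim: r => [|i r IH].
  rewrite big_nil torus_integralE; last first.
    under eq_fun do rewrite big_nil; by split=> x; exact: cvg_cst.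
  under eq_unit_integral do rewrite big_nil.
  under [X in _ +i* X]eq_unit_integral do rewrite big_nil.
  by rewrite !unit_integral_cst.
rewrite big_cons -IH; have cs := ccontinuous_sum r ch; have ci := ch i.
have csr := bm_continuousT cs.1; have csi := bm_continuousT cs.2.
have cir := bm_continuousT ci.1; have cii := bm_continuousT ci.2.
rewrite !torus_integralE//; last first.
  by under eq_fun do rewrite big_cons; exact: ccontinuousD.
under eq_unit_integral do rewrite big_cons ReD.
under [X in _ +i* X = _]eq_unit_integral do rewrite big_cons ImD.
by rewrite !unit_integralD.
Qed.

Lemma ccontinuous_expi (C : R[i]) a : ccontinuous (fun x => C * expi (a * x)).
Proof.
have cc := @continuous_cos_linear a; have cs := @continuous_sin_linear a.
case: C => u v; split=> x; rewrite /expi /=.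
  by apply: cvgB; apply: cvgM; [exact: cvg_cst|exact: cc|exact: cvg_cst|exact: cs].
by apply: cvgD; apply: cvgM; [exact: cvg_cst|exact: cs|exact: cvg_cst|exact: cc].
Qed.

Lemma torus_integral_expi (C : R[i]) (l : int) :
  torus_integral (fun x => C * expi (2 * pi * l%:~R * x)) = if l == 0 then C else 0.
Proof.
rewrite torus_integralE; last exact: ccontinuous_expi.
case: C => u v; rewrite /expi /=.
set w := 2 * pi * l%:~R.
have bc := bm_cos w; have bs := bm_sin w.
have buc := bmZ u bc; have bus := bmZ u bs; have bvc := bmZ v bc; have bvs := bmZ v bs.
rewrite unit_integralB// unit_integralD// !unit_integralZ//.
have cs0 k : unit_integral (fun x : R => cos (2 * pi * k.+1%:R * x)) = 0 /\
             unit_integral (fun x : R => sin (2 * pi * k.+1%:R * x)) = 0.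
  split; [rewrite -[RHS](unit_integral_cos k 0)|rewrite -[RHS](unit_integral_sin k 0)];
  by apply: eq_unit_integral => x _; rewrite addr0.
have [l0|l0] := eqVneq l 0.
  have [-> ->] : unit_integral (fun x => cos (w * x)) = 1 /\
      unit_integral (fun x => sin (w * x)) = 0.
    by rewrite /w l0 mulr0; split; rewrite -[RHS]unit_integral_cst;
      apply: eq_unit_integral => x _; rewrite mul0r ?cos0 ?sin0.
  by rewrite !mulr0 !mulr1 subr0 add0r.
suff [-> ->] : unit_integral (fun x => cos (w * x)) = 0 /\
    unit_integral (fun x => sin (w * x)) = 0 by rewrite !mulr0 subrr addr0.
case: l @w l0 bc bs buc bus bvc bvs => [[//|k]|k] w _ _ _ _ _ _ _; first exact: cs0.
have [c0 s0] := cs0 k.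
have wE x : w * x = - (2 * pi * k.+1%:R * x) by rewrite /w NegzE intrN; ring.
split.
  by under eq_unit_integral do rewrite wE cosN.
have bs : bounded_measurable (fun x : R => sin (2 * pi * k.+1%:R * x)) by exact: bm_sin.
under eq_unit_integral do rewrite wE sinN -mulN1r.
by rewrite unit_integralZ// s0 mulr0.
Qed.

Lemma expiD a b : expi (a + b) = expi a * expi b :> R[i].
Proof.
rewrite /expi cosD sinD; simpc; congr (_ +i* _).
by rewrite addrC mulrC [X in _ + X]mulrC.
Qed.

Lemma fourier_coef_trunc n (h : R -> R[i]) (j : int) : 0 < `|j| <= n%:Z ->
  fourier_coef (fourier_trunc n h) j = fourier_coef h j.
Proof.
move=> jn; set X := [set k : int | 0 < `|k| <= n%:Z].
have finX : finite_set X.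
  apply: (@sub_finite_set _ _ [set` [seq k%:Z - n%:Z | k <- iota 0 n.*2.+1]]); last first.
    exact: finite_seq.
  move=> k /andP[_]; rewrite ler_norml => /andP[kl kr].
  apply/mapP; exists (absz (k + n%:Z)%R); last lia.
  by rewrite mem_iota; lia.
rewrite {1}/fourier_coef.
pose r := finmap.enum_fset (fset_set X).
transitivity (torus_integral (fun x => \sum_(k <- r)
    fourier_coef h k * expi (2 * pi * (k - j)%:~R * x))).
  congr torus_integral; apply/funext => x.
  rewrite /fourier_trunc fsbig_finite//= mulr_suml; apply: eq_bigr => k _.
  rewrite -mulrA -expiD; congr (_ * expi _).
  by rewrite intrB; ring.
rewrite torus_integral_sum; last by move=> k; exact: ccontinuous_expi.
under eq_bigr do rewrite torus_integral_expi subr_eq0.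
rewrite -big_mkcond /=; apply: (finmap.fbig_pred1_inj (k := id)) => //.
by rewrite in_fset_set// inE.
Qed.

Lemma sum_le_esum_int (u : int -> R) (M : nat) (P : pred nat) : (forall k, 0 <= u k) ->
  ((\sum_(k < M | P k) u k.+1%:Z)%:E <=
   \esum_(k in [set k : int | (k != 0)%R]) (u k)%:E)%E.
Proof.
move=> u0; apply: esum_ge.
pose r := [seq k.+1%:Z | k <- iota 0 M & P k].
have ur : uniq r by rewrite map_inj_uniq ?filter_uniq ?iota_uniq// => i j [].
exists [set` r].
  split; first exact: finite_seq.
  by move=> k /mapP[i _ ->].
rewrite -fsbig_seq//= -sumEFin /r big_map big_filter.
by rewrite -(big_mkord P (fun k => (u k.+1%:Z)%:E)) /index_iota subn0.
Qed.

(** Only lower bounds on the norm are needed, so the negative frequencies,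
    which for a real function repeat the positive ones, are dropped. *)
Lemma FL_partial_sum (p m Y : R) (h : R -> R[i]) (M : nat) (P : pred nat) : 0 < p ->
  FL_norm p m h = Y%:E ->
  \sum_(k < M | P k)
    k.+1%:R `^ (m * p) * Normc.normc (fourier_coef h k.+1%:Z) `^ p <= Y `^ p.
Proof.
move=> p0; rewrite /FL_norm; set S := esum _ _ => SY.
have S0 : (0 <= S)%E.
  by apply: esum_ge0 => k _; rewrite lee_fin mulr_ge0 ?powR_ge0.
have SE : S = (Y `^ p)%:E.
  by rewrite -poweR_EFin -SY -poweRrM mulVf ?gt_eqF// poweRe1.
rewrite -lee_fin -SE.
apply: le_trans (sum_le_esum_int M P _); last first.
  by move=> k; rewrite mulr_ge0 ?powR_ge0.
by rewrite lee_fin.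
Qed.

Lemma powR_superadditive (p x y : R) : 1 <= p -> 0 <= x -> 0 <= y ->
  x `^ p + y `^ p <= (x + y) `^ p.
Proof.
move=> p1 x0 y0; have p0 : 0 < p by exact: lt_le_trans p1.
rewrite -(mulr_powRB1 x0 p0) -(mulr_powRB1 y0 p0).
rewrite -(mulr_powRB1 (addr_ge0 x0 y0) p0) mulrDl.
by apply: lerD; apply: ler_wpM2l => //; apply: ge0_ler_powR;
  rewrite ?nnegrE ?subr_ge0 ?lerDl ?lerDr ?addr_ge0.
Qed.

Lemma FL_norm_ge0 (p m : R) (h : R -> R[i]) : (0 <= FL_norm p m h)%E.
Proof. exact: poweR_ge0. Qed.

(** Frequencies k <= n are read off the truncation; for k > n one has
    k^-1 = k^-(m+1) k^m <= n^-(m+1) k^m. The two groups are recombined by the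
    superadditivity of t^p, in place of Minkowski's inequality. *)
Lemma truncation_bound (p m Y Z : R) (h : R -> R[i]) (n M : nat) :
  (0 < n)%N -> 1 <= p -> 0 <= m ->
  FL_norm p m h = Y%:E -> FL_norm p (- 1) (fourier_trunc n h) = Z%:E ->
  \sum_(k < M) (Normc.normc (fourier_coef h k.+1%:Z) / k.+1%:R) `^ p <=
  (Z + n%:R `^ (- (m + 1)) * Y) `^ p.
Proof.
move=> n0 p1 m0 hY hZ; have p0 : 0 < p by exact: lt_le_trans p1.
have Y0 : 0 <= Y by rewrite -lee_fin -hY FL_norm_ge0.
have Z0 : 0 <= Z by rewrite -lee_fin -hZ FL_norm_ge0.
have W0 : 0 <= n%:R `^ (- (m + 1)) * Y by rewrite mulr_ge0 ?powR_ge0.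
apply: le_trans (powR_superadditive p1 Z0 W0).
have c0 z : 0 <= Normc.normc z :> R by case: z => a b; exact: sqrtr_ge0.
have kE k z : (Normc.normc z / k.+1%:R) `^ p =
    k.+1%:R `^ (- 1 * p) * Normc.normc z `^ p :> R.
  by rewrite powRM ?invr_ge0// mulrC powRrM powR_inv1.
rewrite (bigID (fun k : 'I_M => (k < n)%N)); apply: lerD.
  apply: le_trans (FL_partial_sum M (fun k => true && (k < n)%N) p0 hZ).
  apply: ler_sum => k kn; rewrite kE fourier_coef_trunc//.
rewrite powRM ?powR_ge0//.
apply: le_trans (ler_wpM2l (powR_ge0 _ _)
  (FL_partial_sum M (fun k => true && ~~ (k < n)%N) p0 hY)).
rewrite mulr_sumr; apply: ler_sum => k kn; have nk : (n <= k)%N by rewrite leqNgt.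
rewrite kE mulrA ler_wpM2r ?powR_ge0//.
rewrite -powRrM.
have -> : - 1 * p = - (m + 1) * p + m * p :> R by ring.
rewrite powRD; last by rewrite pnatr_eq0 implybT.
rewrite ler_wpM2r ?powR_ge0// mulNr !powRN lef_pV2 ?posrE ?powR_gt0// ?ltr0n//.
apply: ge0_ler_powR; rewrite ?nnegrE ?ler0n//.
  by rewrite mulr_ge0 ?addr_ge0 ?(ltW p0).
by rewrite ler_nat ltnW.
Qed.

(** * Lebesgue norms on the torus *)

Lemma periodic_int f : periodic f 1 -> forall (x : R) (k : int), f (x - k%:~R) = f x.
Proof.
move=> pf x [n|n].
  by rewrite -[LHS](periodicn pf n) -[1 *+ n]/(n%:R) pmulrn subrK.
by rewrite NegzE intrN opprK -[RHS](periodicn pf n.+1) pmulrn.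
Qed.

Lemma periodic_unit f : periodic f 1 -> forall x : R,
  exists2 y, 0 <= y < 1 & f y = f x.
Proof.
move=> pf x; exists (x - (Num.floor x)%:~R); last exact: periodic_int.
have /andP[h1 h2] := floor_itv x; rewrite subr_ge0 h1 /= ltrBlDl.
by move: h2; rewrite intrD addrC.
Qed.

Lemma torus_bounded f : torus_continuous f ->
  exists2 M : R, 0 <= M & forall x, `|f x| <= M.
Proof.
move=> [pf cf]; have [_ [M fM]] := bm_continuousT cf.
exists M.
  by apply: le_trans (fM 0 _); rewrite //= in_itv /= lexx ler01.
move=> x; have [y /andP[y0 y1] <-] := periodic_unit pf x.
by apply: fM; rewrite /= in_itv /= y0 ltW.
Qed.

(** If |f| had zero integral, its primitive would be nondecreasing with equal
    values at 0 and 1, hence constant, although it increases where f does not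
    vanish. *)
Lemma unit_integral_norm_gt0 f : torus_continuous f -> (exists x, f x != 0) ->
  0 < unit_integral (fun x => `|f x|).
Proof.
move=> [pf cf] [x fx]; rewrite lt_neqAle unit_integral_ge0 ?andbT; last by move=> y _.
apply/negP => /eqP/esym f0.
have cnf : continuous (fun x => `|f x|) by move=> y; apply: cvg_norm; exact: cf.
have [F [dF F01 _]] := mean_zero_primitive cnf f0.
have [y /andP[y0 y1] fyx] := periodic_unit pf x.
have fy : 0 < `|f y| by rewrite fyx normr_gt0.
have mvt (u v : R) : 0 <= u -> u <= v -> v <= 1 ->
    exists2 c, u <= c <= v & F v - F u = `|f c| * (v - u).
  move=> u0 uv v1.
  have dF' (z : R) : u <= z <= v -> is_derive z 1 F `|f z|.
    by move=> /andP[uz zv]; apply: dF; rewrite (le_trans u0)// (le_trans zv).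
  have dF'' (z : R) : z \in `]u, v[ -> is_derive z 1 F `|f z|.
    by rewrite in_itv /= => /andP[/ltW uz /ltW zv]; apply: dF'; rewrite uz.
  have [c cI E] := MVT_segment uv dF'' (derive_within_continuous dF').
  by exists c => //; move: cI; rewrite in_itv.
have incr (u v : R) : 0 <= u -> u <= v -> v <= 1 -> F u <= F v.
  move=> u0 uv v1; have [c _ E] := mvt u v u0 uv v1.
  by rewrite -subr_ge0 E mulr_ge0// subr_ge0.
have [d d0 near_y] : exists2 d : R, 0 < d & forall z, `|y - z| < d -> 0 < `|f z|.
  have : `|f z| @[z --> y] --> `|f y| by exact: cnf.
  move=> /cvgr_gt => /(_ _ fy) [d /= d0 h]. by exists d.
pose v := Num.min 1 (y + d / 2).
have yv : y < v by rewrite lt_min y1 ltrDl divr_gt0.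
have v1 : v <= 1 by rewrite ge_min lexx.
have [c /andP[yc cv] E] := mvt y v y0 (ltW yv) v1.
have : 0 < F v - F y.
  rewrite E mulr_gt0 ?subr_gt0// near_y// distrC ger0_norm ?subr_ge0//.
  rewrite ltrBlDl (le_lt_trans cv)// gt_min; apply/orP; right.
  by rewrite ltrD2l ltr_pdivrMr// ltr_pMr// ltr1n.
rewrite subr_gt0 ltNge => /negP; apply.
apply: le_trans (incr v 1 (le_trans y0 (ltW yv)) v1 (lexx _)) _.
by rewrite -F01; apply: incr => //; exact: ltW.
Qed.

Lemma bm_powR f p : bounded_measurable f -> 0 <= p ->
  bounded_measurable (fun x => `|f x| `^ p).
Proof.
move=> bf p0; have [mf [M fM]] := bm_norm bf; split.
  exact: (@measurableT_comp _ _ _ _ _ _ (@powR R ^~ p)).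
exists (`|M| `^ p) => x xI; rewrite ger0_norm ?powR_ge0//.
apply: ge0_ler_powR; rewrite ?nnegrE//.
by have := fM x xI; rewrite normr_id => /le_trans -> //; exact: ler_norm.
Qed.

Lemma integral_torus_bm f : measurable_fun setT f -> bounded_measurable f ->
  (forall x, 0 <= f x) ->
  (\int[torus_measure R]_x (f x)%:E)%E = (unit_integral f)%:E.
Proof.
move=> mf bf f0; rewrite ge0_integral_torus//; last exact/measurable_EFinP.
by rewrite /unit_integral /Rintegral fineK// integrable_fin_num//; exact: bm_integrable.
Qed.

Lemma torus_LnormE f p : continuous f -> 0 < p ->
  torus_Lnorm p%:E f = ((unit_integral (fun x => `|f x| `^ p)) `^ p^-1)%:E.
Proof.
move=> cf p0; rewrite /torus_Lnorm unlock.
rewrite -[LHS]/((\int[torus_measure R]_x (`|f x| `^ p)%:E) `^ p^-1)%E.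
rewrite integral_torus_bm ?poweR_EFin//.
- apply: (@measurableT_comp _ _ _ _ _ _ (@powR R ^~ p)) => //.
  by apply: measurableT_comp => //; exact: continuous_measurable_fun.
- by apply: bm_powR; [exact: bm_continuousT|exact: ltW].
Qed.

Lemma torus_Lnorm1E f : continuous f ->
  torus_Lnorm 1 f = (unit_integral (fun x => `|f x|))%:E.
Proof.
move=> cf; rewrite torus_LnormE// invr1 powRr1; last first.
  by apply: unit_integral_ge0 => x _; exact: powR_ge0.
by congr EFin; apply: eq_unit_integral => x _; rewrite powRr1.
Qed.

Lemma torus_measure_gt0 : (0 < torus_measure R setT)%E.
Proof. by rewrite torus_measureE// setIT leb_I01 lte01. Qed.

(** The case r = oo of Hoelder's inequality, from the almost everywhere bound
    by the essential supremum. *)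
Lemma torus_Lnormy_pairing f : torus_continuous f -> exists b,
  [/\ torus_Lnorm +oo f = b%:E, 0 <= b &
    forall g, measurable_fun setT g -> bounded_measurable g -> (forall x, 0 <= g x) ->
      unit_integral (fun x => `|f x| * g x) <= b * unit_integral g].
Proof.
move=> cf; have [M M0 fM] := torus_bounded cf; have [_ cf'] := cf.
pose B := torus_Lnorm +oo f.
have BE : B = ess_sup (torus_measure R) (fun x => `|f x|%:E)%E.
  by rewrite /B /torus_Lnorm unlock torus_measure_gt0.
have B0 : (0 <= B)%E by exact: Lnorm_ge0.
have BM : (B <= M%:E)%E.
  by rewrite BE; apply/ess_supP; apply: nearW => x; rewrite lee_fin.
have Bfin : B \is a fin_num by rewrite ge0_fin_numE// (le_lt_trans BM) ?ltry.
exists (fine B); split; [by rewrite fineK|by rewrite fine_ge0|].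
move=> g mg bg g0.
have mf : measurable_fun setT (fun x => `|f x|).
  by apply: measurableT_comp => //; exact: continuous_measurable_fun.
have bf := bm_norm (bm_continuousT cf').
rewrite -lee_fin -unit_integralZ//.
have mfg : measurable_fun setT (fun x => `|f x| * g x) by exact: measurable_funM.
have mbg : measurable_fun setT (fun x => fine B * g x) by exact: measurable_funM.
have bfg := bmM bf bg; have bbg := bmZ (fine B) bg.
have fg0 x : 0 <= `|f x| * g x by rewrite mulr_ge0.
have bg0 x : 0 <= fine B * g x by rewrite mulr_ge0// fine_ge0.
rewrite -(integral_torus_bm mfg bfg fg0) -(integral_torus_bm mbg bbg bg0).
apply: ae_ge0_le_integral => //.
- by move=> x _; rewrite lee_fin.
- by apply/measurable_EFinP.
- by move=> x _; rewrite lee_fin.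
- by apply/measurable_EFinP.
have := ess_sup_ge (torus_measure R) (fun x => `|f x|%:E)%E.
rewrite -BE; apply: filterS => x fxB _.
by rewrite lee_fin ler_wpM2r// -lee_fin fineK.
Qed.

(** For continuous f the almost everywhere bound holds everywhere. Pair |f|
    with g = 2 max (|f| - b, 0): since (|f| - b) g = g^2 / 2, the pairing
    inequality forces the continuous function g^2 to have zero integral. *)
Lemma norm_le_torus_Lnormy f b : torus_continuous f ->
  torus_Lnorm +oo f = b%:E -> forall x, `|f x| <= b.
Proof.
move=> cf bE; have [pf cf'] := cf.
have [b' [b'E b0 hb]] := torus_Lnormy_pairing cf.
have {b'E} b'b : b' = b by move: b'E; rewrite bE => -[].
rewrite {}b'b in b0 hb.
move=> x; rewrite leNgt; apply/negP => fx.
pose u y := `|f y| - b; pose g y := `|u y| + u y.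
have cu : continuous u.
  by move=> y; apply: cvgB; [apply: cvg_norm; exact: cf'|exact: cvg_cst].
have cg : continuous g.
  by move=> y; apply: cvgD; [apply: cvg_norm|]; exact: cu.
have g0 y : 0 <= g y by rewrite /g -[X in _ + X]opprK subr_ge0 -normrN ler_norm.
have ug y : u y * g y = g y ^+ 2 / 2.
  rewrite /g; have [uy|uy] := ger0P (u y); first by field.
  by rewrite addNr expr0n /= mulr0 mul0r.
have cg2 : torus_continuous (fun y => g y ^+ 2).
  split; first by move=> y; rewrite /g /u pf.
  by under eq_fun do rewrite expr2; move=> y; apply: cvgM; exact: cg.
have bg := bm_continuousT cg; have bg2 := bm_continuousT cg2.2.
have bfg := bmM (bm_norm (bm_continuousT cf')) bg.
have : 0 < unit_integral (fun y => `|g y ^+ 2|).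
  apply: unit_integral_norm_gt0 => //; exists x.
  by rewrite expf_neq0// gt_eqF// ltr_pwDr ?subr_gt0.
under eq_unit_integral do rewrite ger0_norm ?sqr_ge0//.
have -> : unit_integral (fun y => g y ^+ 2) =
    2 * unit_integral (fun y => `|f y| * g y - b * g y).
  rewrite -unit_integralZ; last by apply: bmB => //; exact: bmZ.
  apply: eq_unit_integral => y _; rewrite -mulrBl -/(u y) ug.
  by rewrite mulrC divfK.
rewrite pmulr_rgt0// unit_integralB//; last exact: bmZ.
rewrite unit_integralZ// subr_gt0 ltNge => /negP; apply; apply: hb => //.
exact: continuous_measurable_fun.
Qed.

(** Hoelder's inequality against indicator functions, in the same form for
    finite and infinite exponents. *)
Lemma torus_Lnorm_hoelder (r : \bar R) (r' : R) f : (1 < r)%E ->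
  r'%:E = hoelder_conjugate r -> torus_continuous f -> exists b,
  [/\ torus_Lnorm r f = b%:E, 0 <= b &
    forall E, measurable E -> E `<=` I01 ->
      unit_integral (fun x => `|f x| * \1_E x) <= b * fine (leb E) `^ r'^-1].
Proof.
have mb1 (E : set R) : measurable E ->
    measurable_fun setT (\1_E : R -> R) /\ bounded_measurable (\1_E : R -> R).
  by move=> mE; split; [exact: measurable_indic|exact: bm_indic].
have int1 (E : set R) : measurable E -> E `<=` I01 ->
    unit_integral (\1_E : R -> R) = fine (leb E).
  move=> mE EI; rewrite /unit_integral /Rintegral; congr fine.
  by rewrite integral_indic// setIidl.
move=> r1 rr' cf; have [_ cf'] := cf; case: r r1 rr' => [r r1 rr'|_ rr'|//].
  have r1' : 1 < r by rewrite -lte_fin.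
  have r0 : 0 < r by apply: lt_trans r1'.
  have r'E : r^-1 + r'^-1 = 1.
    have r'0 : r' != 0.
      apply/eqP => r'0; move: rr'; rewrite r'0 /hoelder_conjugate /= eqe gt_eqF//.
      rewrite -EFinB inver subr_eq0 gt_eqF// -EFinM => -[] /esym/eqP.
      by rewrite mulf_eq0 invr_eq0 subr_eq0 !gt_eqF.
    have := @hoelder_conjugate_eq1 R r%:E.
    rewrite ltNyr -rr' eqe gt_eqF// => /(_ isT isT).
    by rewrite !inver (gt_eqF r0) (negbTE r'0) -EFinD => -[].
  have r'0 : 0 < r'.
    rewrite -invr_gt0 -(ltrD2l r^-1) r'E addr0 invf_lt1//.
  exists ((unit_integral (fun x => `|f x| `^ r)) `^ r^-1).
  split; [exact: torus_LnormE|exact: powR_ge0|move=> E mE EI].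
  have [m1 b1] := mb1 _ mE.
  have mf : measurable_fun setT (fun x => `|f x|).
    by apply: measurableT_comp => //; exact: continuous_measurable_fun.
  have bf := bm_norm (bm_continuousT cf').
  have mfE : measurable_fun setT (fun x => `|f x| * \1_E x) by exact: measurable_funM.
  have bfE := bmM bf b1.
  rewrite -lee_fin EFinM -(torus_LnormE cf' r0).
  rewrite -(integral_torus_bm mfE bfE); last by move=> x; rewrite mulr_ge0.
  have -> : (fine (leb E) `^ r'^-1)%:E = ('N[torus_measure R]_r'%:E[EFin \o \1_E])%E.
    rewrite unlock -[RHS]/((\int[torus_measure R]_x (`|\1_E x| `^ r')%:E) `^ r'^-1)%E.
    rewrite -(int1 _ mE EI) -poweR_EFin -integral_torus_bm//.
    congr (_ `^ _)%E; apply: eq_integral => x _; congr EFin; rewrite indicE.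
    by case: (x \in E); rewrite ?normr1 ?powR1// normr0 powR0// gt_eqF.
  have := @hoelder _ _ _ (torus_measure R) f (\1_E) r r'
    (continuous_measurable_fun cf') m1 r0 r'0 r'E.
  rewrite Lnorm1; apply: le_trans; rewrite le_eqVlt; apply/orP; left; apply/eqP.
  by apply: eq_integral => x _; rewrite /= normrM [X in _ = (_ * X)%:E]ger0_norm.
have r'1 : r' = 1 by move: rr'; rewrite hoelder_conjugatey => -[].
have [b [bE b0 hb]] := torus_Lnormy_pairing cf.
exists b; split => // E mE EI; have [m1 b1] := mb1 _ mE.
rewrite r'1 invr1 powRr1 -?int1//; last exact: unit_integral_ge0.
by apply: hb.
Qed.

(** * The lower bound *)

Lemma hoelder_conjugate_real (r r' : R) : 1 < r -> r'%:E = hoelder_conjugate r%:E ->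
  r' = r / (r - 1).
Proof.
move=> r1; rewrite /hoelder_conjugate /= eqe gt_eqF; last exact: lt_trans r1.
by rewrite -EFinB inver subr_eq0 gt_eqF// -EFinM => -[].
Qed.

Lemma hoelder_conjugate_inv (r : \bar R) (r' : R) : (1 < r)%E ->
  r'%:E = hoelder_conjugate r -> 0 < r' /\ (r^-1 = (1 - r'^-1)%:E)%E.
Proof.
case: r => [r|_|//].
  rewrite lte_fin => r1 /(hoelder_conjugate_real r1) ->.
  have r0 : 0 < r by exact: lt_trans r1.
  split; first by rewrite divr_gt0 ?subr_gt0.
  rewrite inver gt_eqF//; congr EFin; field.
  by rewrite subr_eq0 !gt_eqF.
by rewrite hoelder_conjugatey => -[->]; rewrite invr1 subrr.
Qed.

(** Differentiation multiplies the k-th coefficient by 2 pi k. The factor 2 in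
    the amplitudes, which accounts for the frequency -k, is absorbed by
    2 <= 2 pi. *)
Lemma amplitude_fourier_coef f F (k : nat) : continuous f ->
  (forall x : R, 0 <= x <= 1 -> is_derive x 1 F (f x)) -> F 0 = F 1 ->
  amplitude (fun k => 2 * cos_coef F k.+1) (fun k => 2 * sin_coef F k.+1) k <=
  Normc.normc (fourier_coef (fun x => (f x)%:C) k.+1%:Z) / k.+1%:R.
Proof.
move=> cf dF F01; rewrite fourier_coef_real//.
have [-> ->] := coef_by_parts k dF F01 cf.
rewrite /amplitude /= opprK.
set c := cos_coef F k.+1; set d := sin_coef F k.+1; set w := 2 * pi * k.+1%:R.
have w0 : 0 < w := freq_gt0 k.
have sqrtZ (u v z : R) : 0 <= z ->
    Num.sqrt ((z * u) ^+ 2 + (z * v) ^+ 2) = z * Num.sqrt (u ^+ 2 + v ^+ 2).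
  by move=> z0; rewrite !exprMn -mulrDr sqrtrM ?sqr_ge0// sqrtr_sqr ger0_norm.
rewrite !sqrtZ ?(ltW w0)// [d ^+ 2 + _]addrC mulrAC ler_wpM2r ?sqrtr_ge0//.
by rewrite /w mulfK// ler_peMr// (le_trans _ (pi_ge2 R))// ler1n.
Qed.

Lemma powRV (x p : R) : 0 <= x -> x^-1 `^ p = (x `^ p)^-1.
Proof. by move=> x0; rewrite -powR_inv1// -powRrM mulN1r powRN. Qed.

(** The heart of the matter. With lam = a / (32 N), half of the mass a of f
    lies where |F| > lam, so by Hoelder's inequality that set has measure at
    least (a / (2 b))^r'; the weak-type bound says that it has measure at most
    (2 tau / lam)^s. Solving for tau gives the claim. *)
Lemma sign_change_bound (s s' : R) (r : \bar R) (r' : R) f (N : nat) :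
  2 <= s -> s' = s / (s - 1) -> (1 < r)%E -> r'%:E = hoelder_conjugate r ->
  torus_continuous f -> (exists x, f x != 0) -> unit_integral f = 0 ->
  is_sign_changes f N -> exists a b,
  [/\ 0 < a <= b, torus_Lnorm 1 f = a%:E, torus_Lnorm r f = b%:E, (0 < N)%N &
   forall tau, 0 < tau ->
     (forall M, \sum_(k < M) (Normc.normc (fourier_coef (fun x => (f x)%:C) k.+1%:Z) /
        k.+1%:R) `^ s' <= tau `^ s') ->
     a `^ (1 + r' / s) / b `^ (r' / s) <= 64 * 2 `^ (r' / s) * N%:R * tau].
Proof.
move=> s2 s'E r1 rr' cf nf f0 fN; have [pf cf'] := cf.
have [r'0 _] := hoelder_conjugate_inv r1 rr'.
have s0 : 0 < s by exact: lt_le_trans s2.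
have s'0 : 0 < s' by rewrite s'E divr_gt0 ?subr_gt0// (lt_le_trans _ s2)// ltr1n.
have [F [dF F01 F0]] := mean_zero_primitive cf' f0.
pose a := unit_integral (fun x => `|f x|).
have a0 : 0 < a by exact: unit_integral_norm_gt0.
have N0 : (0 < N)%N by exact: (sign_changes_gt0 cf' dF F01 _ fN).
have NR0 : 0 < N%:R :> R by rewrite ltr0n.
have [b [bE b0 hb]] := torus_Lnorm_hoelder r1 rr' cf.
have ab : a <= b.
  have := hb I01 (measurable_itv `[0, 1]) (@subset_refl _ _).
  rewrite leb_I01 powR1 mulr1; apply: le_trans.
  rewrite le_eqVlt; apply/orP; left; apply/eqP; apply: eq_unit_integral => x xI.
  by rewrite indicE mem_set// mulr1.
have b0' : 0 < b by exact: lt_le_trans ab.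
exists a, b; split => //; [by rewrite a0|exact: torus_Lnorm1E|].
move=> tau tau0 Hsum.
pose lam := a / (32 * N%:R).
have lam0 : 0 < lam by rewrite divr_gt0// mulr_gt0.
pose E := level_above lam F.
have mE : measurable E by apply: measurable_level_above; case: (bm_derive dF).
have Esub : E `<=` I01 by exact: subIsetl.
have mass := level_mass cf' dF F01 fN erefl a0; rewrite -/lam -/E -/a in mass.
have amp M : \sum_(k < M) amplitude (fun k => 2 * cos_coef F k.+1)
     (fun k => 2 * sin_coef F k.+1) k `^ s' <= tau `^ s'.
  apply: le_trans (Hsum M); apply: ler_sum => k _.
  have h := amplitude_fourier_coef k cf' dF F01.
  have a0' := sqrtr_ge0 _ : 0 <= amplitude (fun k => 2 * cos_coef F k.+1)
     (fun k => 2 * sin_coef F k.+1) k.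
  by apply: ge0_ler_powR; rewrite ?nnegrE ?(ltW s'0)// (le_trans a0' h).
have := weak_type_primitive s2 s'E tau0 lam0 dF F01 cf' F0 amp.
rewrite -/E => Ele.
pose Q := 2 * tau / lam.
have Q0 : 0 < Q by rewrite divr_gt0// mulr_gt0.
have El : fine (leb E) <= Q `^ s.
  have Efin : leb E \is a fin_num by rewrite ge0_fin_numE// (le_lt_trans Ele) ?ltry.
  by rewrite -lee_fin fineK.
have h1 : a / 2 <= b * Q `^ (s / r').
  apply: le_trans mass _; apply: le_trans (hb E mE Esub) _.
  rewrite ler_wpM2l// powRrM ge0_ler_powR ?nnegrE ?invr_ge0 ?(ltW r'0) ?powR_ge0//.
  exact: fine_ge0.
pose q := r' / s; have q0 : 0 < q by rewrite divr_gt0.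
have h2 : (a / (2 * b)) `^ q <= Q.
  have -> : Q = (Q `^ (s / r')) `^ q.
    have e1 : s / r' * q = 1 by rewrite /q; field; rewrite !gt_eqF.
    by rewrite -powRrM e1 powRr1// ltW.
  apply: ge0_ler_powR; rewrite ?nnegrE ?powR_ge0 ?(ltW q0) ?divr_ge0 ?mulr_ge0 ?(ltW a0)//.
  by rewrite invfM mulrA ler_pdivrMr// [leRHS]mulrC.
rewrite -/q.
have -> : a `^ (1 + q) / b `^ q = a * 2 `^ q * (a / (2 * b)) `^ q.
  rewrite powRD ?(gt_eqF a0) ?implybT// powRr1 ?(ltW a0)//.
  rewrite powRM ?(ltW a0) ?invr_ge0 ?mulr_ge0// powRV ?mulr_ge0// powRM//.
  by field; rewrite !gt_eqF ?powR_gt0.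
apply: le_trans (ler_wpM2l _ h2) _; first by rewrite mulr_ge0 ?powR_ge0 ?(ltW a0).
rewrite /Q /lam le_eqVlt; apply/orP; left; apply/eqP.
by field; rewrite !gt_eqF.
Qed.

Lemma weighted_amgm (x y w : R) : 0 <= x -> 0 <= y -> 0 <= w <= 1 ->
  x `^ (1 - w) * y `^ w <= (1 - w) * x + w * y.
Proof.
move=> x0 y0 /andP[]; rewrite le_eqVlt => /predU1P[<- _|w0].
  by rewrite subr0 powRr1// powRr0 mulr1 mul1r mul0r addr0.
rewrite le_eqVlt => /predU1P[->|w1].
  by rewrite subrr powRr0 powRr1// !mul1r mul0r add0r.
have w1' : 0 < 1 - w by rewrite subr_gt0.
have := @conjugate_powR R (x `^ (1 - w)) (y `^ w) (1 - w)^-1 w^-1.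
rewrite !invrK subrK !powR_ge0 !invr_gt0 => /(_ isT isT w1' w0 erefl).
by rewrite -!powRrM !mulfV ?gt_eqF// !powRr1// [x * _]mulrC [y * w]mulrC.
Qed.

(** Log-convexity of L^p norms between L^1 and L^r: for 1/p = 1 - theta + theta/r
    the exponent of b is theta = r' (1 - 1/p). For finite r, the weighted
    arithmetic-geometric inequality is applied pointwise to |f| / a and
    (|f| / b)^r, both of which have integral 1. *)
Lemma torus_Lnorm_interpolation (r : \bar R) (r' a b p : R) f : (1 < r)%E ->
  r'%:E = hoelder_conjugate r -> torus_continuous f ->
  1 <= p -> (r^-1 <= p^-1%:E)%E -> 0 < a -> 0 < b ->
  torus_Lnorm 1 f = a%:E -> torus_Lnorm r f = b%:E ->
  exists P, [/\ torus_Lnorm p%:E f = P%:E, 0 <= P &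
    P <= a `^ (1 - r' * (1 - p^-1)) * b `^ (r' * (1 - p^-1))].
Proof.
move=> r1 rr' cf p1 rp a0 b0 aE bE; have [_ cf'] := cf.
have p0 : 0 < p by exact: lt_le_trans p1.
have bf := bm_continuousT cf'.
pose I := unit_integral (fun x => `|f x| `^ p).
have I0 : 0 <= I by apply: unit_integral_ge0 => x _; exact: powR_ge0.
have aI : unit_integral (fun x => `|f x|) = a.
  by move: aE; rewrite torus_Lnorm1E// => -[].
exists (I `^ p^-1); split; [exact: torus_LnormE|exact: powR_ge0|].
have root u v c d : 0 <= u -> 0 <= v -> I <= u `^ c * v `^ d ->
    I `^ p^-1 <= u `^ (c / p) * v `^ (d / p).
  move=> u0 v0 h; rewrite !powRrM -powRM ?powR_ge0//.
  by apply: ge0_ler_powR; rewrite ?nnegrE ?invr_ge0 ?mulr_ge0 ?powR_ge0 ?(ltW p0).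
case: r r1 rr' rp bE => [r|_|//]; last first.
  rewrite hoelder_conjugatey => -[->] _ bE.
  have fb := norm_le_torus_Lnormy cf bE.
  have -> : 1 - 1 * (1 - p^-1) = 1 / p :> R by ring.
  have -> : 1 * (1 - p^-1) = (p - 1) / p :> R by field; rewrite gt_eqF.
  apply: root; [exact: ltW|exact: ltW|].
  rewrite powRr1 ?(ltW a0)// mulrC -aI -unit_integralZ; last exact: bm_norm.
  apply: le_unit_integral; [exact: bm_powR (ltW p0)|exact/bmZ/bm_norm|move=> x _].
  rewrite -(mulr_powRB1 (normr_ge0 _) p0) mulrC ler_wpM2r//.
  by apply: ge0_ler_powR; rewrite ?nnegrE ?subr_ge0 ?(ltW b0).
rewrite lte_fin => r1 /(hoelder_conjugate_real r1) r'E rp bE.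
have r0 : 0 < r by exact: lt_trans r1.
have rm1 : 0 < r - 1 by rewrite subr_gt0.
have pr : p <= r.
  by move: rp; rewrite inver gt_eqF// lee_fin lef_pV2.
pose w := (p - 1) / (r - 1).
have wI : 0 <= w <= 1.
  by rewrite divr_ge0 ?subr_ge0 ?(ltW r1)//= ler_pdivrMr// mul1r lerD2r.
have -> : 1 - r' * (1 - p^-1) = (1 - w) / p.
  by rewrite r'E /w; field; rewrite !gt_eqF.
have -> : r' * (1 - p^-1) = w * r / p.
  by rewrite r'E /w; field; rewrite !gt_eqF.
apply: root; [exact: ltW|exact: ltW|].
have bI : unit_integral (fun x => `|f x| `^ r) = b `^ r.
  move: bE; rewrite torus_LnormE// => -[] <-.
  rewrite -powRrM mulVf ?gt_eqF// powRr1//.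
  by apply: unit_integral_ge0 => x _; exact: powR_ge0.
set K := _ * _; have K0 : 0 < K by rewrite mulr_gt0 ?powR_gt0.
have bn := bmZ ((1 - w) / a) (bm_norm bf); have br := bm_powR bf (ltW r0).
have br' := bmZ (w / b `^ r) br.
apply: (@le_trans _ _ (unit_integral (fun x =>
   K * ((1 - w) / a * `|f x| + w / b `^ r * `|f x| `^ r)))); last first.
  rewrite unit_integralZ; last exact: bmD.
  rewrite unit_integralD// !unit_integralZ//; last exact: bm_norm.
  rewrite aI bI !divfK ?gt_eqF ?powR_gt0//.
  by rewrite subrK mulr1.
apply: le_unit_integral; [exact: bm_powR (ltW p0)|exact/bmZ/bmD|move=> x _].
have := @weighted_amgm (`|f x| / a) ((`|f x| / b) `^ r) w.
rewrite divr_ge0 ?(ltW a0)// powR_ge0 => /(_ isT isT wI).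
set L := _ * _; set U := _ + _ => LU.
have -> : (1 - w) / a * `|f x| + w / b `^ r * `|f x| `^ r = U.
  rewrite /U powRM ?invr_ge0 ?(ltW b0)// powRV ?(ltW b0)//.
  by rewrite mulrAC -mulrA [w / _ * _]mulrAC -[w * _ / _]mulrA.
apply: le_trans (ler_wpM2l (ltW K0) LU).
have [fx0|fx0] := eqVneq (f x) 0.
  by rewrite fx0 normr0 powR0 ?gt_eqF// mulr_ge0 ?(ltW K0)// /L mulr_ge0 ?powR_ge0.
have fxp : 0 < `|f x| by rewrite normr_gt0.
rewrite /K /L -powRrM !powRM ?invr_ge0 ?(ltW a0) ?(ltW b0)// !powRV ?(ltW a0) ?(ltW b0)//.
rewrite [r * w]mulrC.
have -> : `|f x| `^ p = `|f x| `^ (1 - w) * `|f x| `^ (w * r).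
  rewrite -powRD ?(gt_eqF fxp) ?implybT//; congr (_ `^ _).
  by rewrite /w; field; rewrite gt_eqF.
rewrite le_eqVlt; apply/orP; left; apply/eqP.
by field; rewrite !gt_eqF ?powR_gt0.
Qed.

(** With Y and Z the norms of f and of its truncation, every
    tau > Z + n^-(m+1) Y is admissible in the hypothesis by
    [truncation_bound]; let tau decrease to that value. *)
Lemma ratio_le_truncation (s' m C K : R) f (n N : nat) :
  (0 < n)%N -> 0 <= m -> 1 <= s' -> 0 < C -> (0 < N)%N ->
  (FL_norm s' m (fun x => (f x)%:C) < +oo)%E ->
  (forall tau, 0 < tau ->
     (forall M, \sum_(k < M) (Normc.normc (fourier_coef (fun x => (f x)%:C) k.+1%:Z) /
        k.+1%:R) `^ s' <= tau `^ s') -> K <= C * N%:R * tau) ->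
  ((C^-1)%:E * (K%:E / (N%:R)%:E)
     - (n%:R `^ (- (m + 1)))%:E * FL_norm s' m (fun x => (f x)%:C)
   <= FL_norm s' (-1) (fourier_trunc n (fun x => (f x)%:C)))%E.
Proof.
move=> n0 m0 s'1 C0 N0 Yfin KC.
have Y0 := FL_norm_ge0 s' m (fun x => (f x)%:C).
have Z0 := FL_norm_ge0 s' (- 1) (fourier_trunc n (fun x => (f x)%:C)).
case YE : (FL_norm s' m _) Yfin Y0 => [Y||]// _; rewrite lee_fin => Y0.
case ZE : (FL_norm s' (- 1) _) Z0 => [Z||]//; last by move=> _; rewrite leey.
rewrite lee_fin => Z0.
have N0' : 0 < N%:R :> R by rewrite ltr0n.
rewrite inver (gt_eqF N0') -!EFinM -EFinB lee_fin lerBlDr.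
apply/ler_addgt0Pr => e e0.
have W0 : 0 <= n%:R `^ (- (m + 1)) * Y by rewrite mulr_ge0 ?powR_ge0.
rewrite ler_pdivrMl// ler_pdivrMr// mulrAC.
apply: KC => [|M]; first by rewrite ltr_wpDl// addr_ge0.
apply: le_trans (truncation_bound M n0 s'1 m0 YE ZE) _.
have h0 : 0 <= Z + n%:R `^ (- (m + 1)) * Y by rewrite addr_ge0.
have s'0 : 0 <= s' by exact: le_trans s'1.
by apply: ge0_ler_powR; rewrite ?nnegrE ?lerDl ?(ltW e0)// addr_ge0 ?(ltW e0).
Qed.

(** An exponent p in [1, oo] is handled through i = 1/p in [0, 1], so that the
    infinite exponent is the case i = 0. *)
Lemma inve_ge1 (x : \bar R) : (1 <= x)%E -> exists i,
  [/\ (x^-1 = i%:E)%E, 0 <= i <= 1 &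
      0 < i -> exists2 p : R, 1 <= p & x = p%:E /\ p^-1 = i].
Proof.
case: x => [p|_|//].
  rewrite lee_fin => p1; have p0 : 0 < p by exact: lt_le_trans p1.
  exists p^-1; split; [by rewrite inver gt_eqF| |by exists p].
  by rewrite invr_ge0 (ltW p0) invf_le1.
by exists 0; rewrite invey ltxx ler01 lexx; split.
Qed.

(** Here u = 1/p and v = 1/q. With t the sum of the two interpolation exponents
    of b, the left-hand side is at most a (a / b)^(1 - t) and the right-hand
    side is a (a / b)^(r' / s). As a <= b, the claim reduces to 1 - t >= r' / s,
    which is the condition on the exponents. *)
Lemma Lnorm_ratio_le_L1 (s r' a b u v A B : R) : 0 < s -> 0 < r' -> 0 < a <= b ->
  0 <= A -> 0 <= B ->
  A <= a `^ (1 - r' * (1 - u)) * b `^ (r' * (1 - u)) ->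
  B <= a `^ (1 - r' * (1 - v)) * b `^ (r' * (1 - v)) ->
  1 + s^-1 <= u + v - (1 - r'^-1) ->
  A * B / b <= a `^ (1 + r' / s) / b `^ (r' / s).
Proof.
move=> s0 r'0 /andP[a0 ab] A0 B0 Ale Ble uv.
have b0 : 0 < b by exact: lt_le_trans ab.
pose t := r' * (1 - u) + r' * (1 - v).
have tle : r' / s <= 1 - t.
  have h := ler_wpM2l (ltW r'0) uv.
  have E : r' * r'^-1 = 1 by rewrite mulfV// gt_eqF.
  rewrite /t; lra.
have powa x y : a `^ (x + y) = a `^ x * a `^ y.
  by rewrite powRD// (gt_eqF a0) implybT.
have powb x y : b `^ (x + y) = b `^ x * b `^ y.
  by rewrite powRD// (gt_eqF b0) implybT.
have AB : A * B <= a `^ (2 - t) * b `^ t.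
  apply: le_trans (ler_pM A0 B0 Ale Ble) _.
  rewrite mulrACA -powa -powb le_eqVlt; apply/orP; left; apply/eqP.
  by congr (a `^ _ * _); rewrite /t; ring.
rewrite ler_pdivrMr//; apply: le_trans AB _.
have -> : a `^ (2 - t) * b `^ t = a * b * (a / b) `^ (1 - t).
  rewrite powRM ?invr_ge0 ?(ltW a0) ?(ltW b0)// powRV ?(ltW b0)//.
  have -> : 2 - t = 1 + (1 - t) by ring.
  rewrite powa powRr1 ?(ltW a0)//.
  have E : b `^ (1 - t) * b `^ t = b by rewrite -powb subrK powRr1// ltW.
  rewrite -{2}E; field; by rewrite gt_eqF ?powR_gt0.
have -> : a `^ (1 + r' / s) / b `^ (r' / s) * b = a * b * (a / b) `^ (r' / s).
  rewrite powRM ?invr_ge0 ?(ltW a0) ?(ltW b0)// powRV ?(ltW b0)//.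
  by rewrite powa powRr1 ?(ltW a0)//; ring.
rewrite ler_wpM2l ?mulr_ge0 ?(ltW a0) ?(ltW b0)//.
apply: ger_powR => //; rewrite divr_gt0//= ler_pdivrMr// mul1r //.
Qed.

End Auxiliary.

Theorem theorem3p1 (R : realType) (s s' : R) (hs : 2 <= s)
    (hs' : s'%:E = hoelder_conjugate s%:E) :
  (forall p q r : \bar R,
     (1 <= p)%E -> (1 <= q)%E -> (1 <= r)%E ->
     (1 + (s%:E)^-1 <= p^-1 + q^-1 - r^-1)%E ->
     exists2 c : R, 0 < c &
       forall (n : nat) (m : R) (phi : R -> R) (N : nat),
         (1 <= n)%N -> 0 <= m ->
         torus_continuous phi ->
         (FL_norm s' m (fun x => (phi x)%:C) < +oo)%E ->
         (exists x, phi x != 0) ->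
         (\int[torus_measure R]_x (phi x)%:E = 0)%E ->
         is_sign_changes phi N ->
         (c%:E * (Lnorm_ratio p q r phi / (N%:R)%:E)
            - (n%:R `^ (- (m + 1)))%:E * FL_norm s' m (fun x => (phi x)%:C)
          <= FL_norm s' (-1) (fourier_trunc n (fun x => (phi x)%:C)))%E) /\
  (forall (r : \bar R) (r' : R),
     (1 < r)%E -> r'%:E = hoelder_conjugate r ->
     exists2 c : R, 0 < c &
       forall (n : nat) (m : R) (phi : R -> R) (N : nat),
         (1 <= n)%N -> 0 <= m ->
         torus_continuous phi ->
         (FL_norm s' m (fun x => (phi x)%:C) < +oo)%E ->
         (exists x, phi x != 0) ->
         (\int[torus_measure R]_x (phi x)%:E = 0)%E ->
         is_sign_changes phi N ->
         (c%:E * (L1_ratio s r r' phi / (N%:R)%:E)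
            - (n%:R `^ (- (m + 1)))%:E * FL_norm s' m (fun x => (phi x)%:C)
          <= FL_norm s' (-1) (fourier_trunc n (fun x => (phi x)%:C)))%E).
Proof.
have s1 : 1 < s by apply: lt_le_trans hs; rewrite ltr1n.
have s0 : 0 < s by exact: lt_trans s1.
have s'E := hoelder_conjugate_real s1 hs'.
have s'1 : 1 <= s'.
  by rewrite s'E ler_pdivlMr ?subr_gt0// mul1r gerBl.
have mean0 (phi : R -> R) : torus_continuous phi ->
    (\int[torus_measure R]_x (phi x)%:E = 0)%E -> unit_integral phi = 0.
  by move=> [_ cphi] h; rewrite -Rintegral_torus// /Rintegral h.
pose C (r' : R) := 64 * 2 `^ (r' / s).
have C0 r' : 0 < C r' by rewrite mulr_gt0 ?powR_gt0.
split; last first.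
  move=> r r' r1 rr'; exists (C r')^-1; first by rewrite invr_gt0.
  move=> n m phi N n1 m0 cphi Yfin nphi /(mean0 _ cphi) phi0 phiN.
  have [a [b [/andP[a0 ab] aE bE N0 bound]]] :=
    sign_change_bound hs s'E r1 rr' cphi nphi phi0 phiN.
  have b0 : 0 < b by exact: lt_le_trans ab.
  rewrite /L1_ratio aE bE !poweR_EFin inver gt_eqF ?powR_gt0// -EFinM.
  exact: ratio_le_truncation.
move=> p q r p1 q1 r1 pqr.
have [u [uE /andP[u0 u1] pu]] := inve_ge1 p1.
have [v [vE /andP[v0 v1] qv]] := inve_ge1 q1.
have [w [wE /andP[w0 w1] _]] := inve_ge1 r1.
have sV0 : 0 < s^-1 by rewrite invr_gt0.
move: pqr; rewrite uE vE wE inver gt_eqF// -EFinN -!EFinD lee_fin => uvw.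
(* r = 1 would require 1/p + 1/q >= 2 + 1/s *)
have {}r1 : (1 < r)%E.
  rewrite lt_neqAle r1 andbT; apply/eqP => rE.
  by move: wE; rewrite -rE inve1 => -[w1']; lra.
have [r' rr'] : exists r' : R, r'%:E = hoelder_conjugate r.
  case: (r) r1 => [x|_|//]; last by exists 1; rewrite hoelder_conjugatey.
  rewrite lte_fin => x1; exists (x / (x - 1)).
  rewrite /hoelder_conjugate /= eqe gt_eqF; last exact: lt_trans x1.
  by rewrite -EFinB inver subr_eq0 gt_eqF// -EFinM.
have [r'0 rV] := hoelder_conjugate_inv r1 rr'.
have {rV} wr' : w = 1 - r'^-1 by move: wE; rewrite rV => -[].
have [pr p1' [pE pru]] : exists2 t : R, 1 <= t & p = t%:E /\ t^-1 = u.
  by apply: pu; lra.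
have [qr q1' [qE qrv]] : exists2 t : R, 1 <= t & q = t%:E /\ t^-1 = v.
  by apply: qv; lra.
exists (C r')^-1; first by rewrite invr_gt0.
move=> n m phi N n1 m0 cphi Yfin nphi /(mean0 _ cphi) phi0 phiN.
have [a [b [/andP[a0 ab] aE bE N0 bound]]] :=
  sign_change_bound hs s'E r1 rr' cphi nphi phi0 phiN.
have b0 : 0 < b by exact: lt_le_trans ab.
have [A [AE A0 Ale]] : exists A, [/\ torus_Lnorm pr%:E phi = A%:E, 0 <= A &
    A <= a `^ (1 - r' * (1 - pr^-1)) * b `^ (r' * (1 - pr^-1))].
  by apply: torus_Lnorm_interpolation r1 rr' cphi p1' _ a0 b0 aE bE;
    rewrite wE pru lee_fin; lra.
have [B [BE B0 Ble]] : exists B, [/\ torus_Lnorm qr%:E phi = B%:E, 0 <= B &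
    B <= a `^ (1 - r' * (1 - qr^-1)) * b `^ (r' * (1 - qr^-1))].
  by apply: torus_Lnorm_interpolation r1 rr' cphi q1' _ a0 b0 aE bE;
    rewrite wE qrv lee_fin; lra.
rewrite /Lnorm_ratio pE qE AE BE bE inver gt_eqF// -!EFinM.
apply: ratio_le_truncation => // tau tau0 /(bound tau tau0).
apply: le_trans; apply: Lnorm_ratio_le_L1 A0 B0 Ale Ble _ => //.
  by rewrite a0.
by rewrite pru qrv -wr'.
Qed.
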